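(* Let $n \in \mathbb{N}$, $n \geq 2$, be arbitrary and let $\mathcal{PB}_{n}$ be the partial Brauer monoid of degree $n$. Then the maximal subsemigroups of $\mathcal{PB}_{n}$ are precisely: (a) $(\mathcal{PB}_{n} \setminus \mathcal{S}_{n}) \cup U$, where $U$ is a maximal subgroup of $\mathcal{S}_{n}$ (type (M5)); (b) $\mathcal{PB}_{n} \setminus \{\alpha \in \mathcal{PB}_{n} : \operatorname{rank}(\alpha) = n - 1\}$ (type (M1)); (c) $\mathcal{PB}_{n} \setminus \{\alpha \in \mathcal{PB}_{n} : \operatorname{rank}(\alpha) = n - 2\ \text{and}\ \ker(\alpha)\ \text{is non-trivial}\}$ (type (M4)); and (d) $\mathcal{PB}_{n} \setminus \{\alpha \in \mathcal{PB}_{n} : \operatorname{rank}(\alpha) = n - 2\ \text{and}\ \operatorname{coker}(\alpha)\ \text{is non-trivial}\}$ (type (M3)). In particular, for $n \geq 2$, there are $s_{n} + 3$ maximal subsemigroups of $\mathcal{PB}_{n}$, where $s_{n}$ denotes the number of maximal subgroups of the symmetric group of degree $n$. The partial Brauer monoid $\mathcal{PB}_{1} = \mathcal{P}_{1}$ is a semilattice of order $2$: its maximal subsemigroups are each of its singleton subsets.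
   Context: $\mathbb{N}=\{1,2,3,\ldots\}$. A maximal subsemigroup of a semigroup $S$ (maximal subgroup of a group) is a proper subsemigroup (subgroup) not contained in any other proper one. A semilattice is a commutative semigroup of idempotents. A partition of degree $n$ is an equivalence relation on $\{1,\ldots,n\}\cup\{1',\ldots,n'\}$; its classes are called blocks; a block is transverse if it contains both unprimed and primed points. The rank of a partition is its number of transverse blocks. The product $\alpha\beta$: replace each $i'$ by $i''$ in $\alpha$ to get $\alpha'$, replace each $i$ by $i''$ in $\beta$ to get $\beta'$; let $(\alpha\beta)'$ be the smallest equivalence on $\{1,\ldots,n\}\cup\{1',\ldots,n'\}\cup\{1'',\ldots,n''\}$ containing $\alpha'\cup\beta'$; then $\alpha\beta$ is the restriction of $(\alpha\beta)'$ to $\{1,\ldots,n\}\cup\{1',\ldots,n'\}$. $\mathcal{P}_n$ is the monoid of all partitions of degree $n$; $\mathcal{PB}_n$ is the submonoid of those partitions all of whose blocks have size at most $2$. $\alpha^*$ is obtained from $\alpha$ by interchanging $i$ and $i'$ for all $i$. $\ker(\alpha)$ is the restriction of the equivalence $\alpha$ to $\{1,\ldots,n\}$ (trivial means equality), and $\operatorname{coker}(\alpha)=\ker(\alpha^* )$. $\mathcal{S}_n$ denotes the group of units: the partitions all of whose blocks have the form $\{i,j'\}$, a copy of the symmetric group of degree $n$. Types: a maximal subsemigroup $M$ of a finite monoid $S$ arises from the $\mathscr{J}$-class $J$ if $S\setminus M\subseteq J$; when $J$ is regular, $M$ has type (M1) if $M\cap J=\varnothing$; (M3) if $M\cap J$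 is a non-empty union of $\mathscr{L}$-classes of $J$; (M4) if it is a non-empty union of $\mathscr{R}$-classes of $J$; (M5) if it meets every $\mathscr{H}$-class of $J$. *)

(* Defs.v *)
From HB Require Import structures.
From mathcomp Require Import all_boot all_fingroup all_solvable.

Set Implicit Arguments.
Unset Strict Implicit.
Unset Printing Implicit Defensive.

Local Open Scope group_scope.

(* An equivalence relation on a finite type, given as its set of pairs. *)
Definition is_equiv (T : finType) (e : {set T * T}) : bool :=
  [&& [forall x, (x, x) \in e],
      [forall x, forall y, ((x, y) \in e) ==> ((y, x) \in e)]
    & [forall x, forall y, forall z,
         ((x, y) \in e) ==> ((y, z) \in e) ==> ((x, z) \in e)]].

Lemma is_equivP (T : finType) (e : {set T * T}) :
  reflect [/\ forall x, (x, x) \in e,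
              forall x y, (x, y) \in e -> (y, x) \in e
            & forall x y z, (x, y) \in e -> (y, z) \in e -> (x, z) \in e]
          (is_equiv e).
Proof.
apply: (iffP and3P) => -[].
  move=> /forallP r /forallP s /forallP t; split=> // [x y xy|x y z xy yz].
    by move/forallP/(_ y)/implyP: (s x); apply.
  by move/forallP/(_ y)/forallP/(_ z)/implyP/(_ xy)/implyP: (t x); apply.
move=> r s t; split; first exact/forallP.
  by apply/forallP=> x; apply/forallP=> y; apply/implyP/s.
do 3![apply/forallP=> ?]; apply/implyP=> xy; apply/implyP; exact: t xy.
Qed.

Definition generated_equiv (T : finType) (r : {set T * T}) : {set T * T} :=
  [set p | connect (fun x y => ((x, y) \in r) || ((y, x) \in r)) p.1 p.2].

Lemma generated_equiv_sub (T : finType) (r : {set T * T}) :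
  r \subset generated_equiv r.
Proof.
by apply/subsetP=> -[x y] xy; rewrite inE; apply: connect1; rewrite xy.
Qed.

Lemma generated_equivP (T : finType) (r : {set T * T}) :
  is_equiv (generated_equiv r).
Proof.
apply/is_equivP; split=> [x|x y|x y z]; rewrite !inE ?connect0 //=; last first.
  exact: connect_trans.
by rewrite (sym_connect_sym _) // => a b; rewrite orbC.
Qed.

Lemma generated_equiv_min (T : finType) (r e : {set T * T}) :
  is_equiv e -> r \subset e -> generated_equiv r \subset e.
Proof.
case/is_equivP=> rf sy tr /subsetP re; apply/subsetP=> -[x y]; rewrite inE /=.
case/connectP=> p + ->; elim: p x => [|z p IHp] x //= /andP[xz /IHp].
by apply: tr; case/orP: xz => /re // /sy.
Qed.

(* The points 1, ..., n and 1', ..., n': [inl i] is unprimed, [inr i] primed. *)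
Definition point (n : nat) : finType := ('I_n + 'I_n)%type.

Definition swap_point (n : nat) (x : point n) : point n :=
  match x with inl i => inr i | inr i => inl i end.

Record npart (n : nat) := NPart {
  npart_rel :> {set point n * point n};
  npart_equiv : is_equiv npart_rel }.

HB.instance Definition _ (n : nat) := [isSub for @npart_rel n].
HB.instance Definition _ (n : nat) := [Finite of npart n by <:].

(* The points i, i' and i'' used for the product: [inl x] is the point x of     *)
(* degree n, and [inr i] is i''.                                              *)
Definition point3 (n : nat) : finType := (point n + 'I_n)%type.

Definition upper (n : nat) (x : point n) : point3 n :=
  match x with inl i => inl (inl i) | inr i => inr i end.

Definition lower (n : nat) (x : point n) : point3 n :=
  match x with inl i => inr i | inr i => inl (inr i) end.

Definition stack (n : nat) (a b : npart n) : {set point3 n * point3 n} :=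
  generated_equiv ([set (upper p.1, upper p.2) | p in npart_rel a]
                   :|: [set (lower p.1, lower p.2) | p in npart_rel b]).

Definition mul_rel (n : nat) (a b : npart n) : {set point n * point n} :=
  [set p | (inl p.1, inl p.2) \in stack a b].

Fact mul_rel_equiv (n : nat) (a b : npart n) : is_equiv (mul_rel a b).
Proof.
have/is_equivP[r s t] := generated_equivP
  ([set (upper p.1, upper p.2) | p in npart_rel a]
   :|: [set (lower p.1, lower p.2) | p in npart_rel b]).
apply/is_equivP; split=> [x|x y|x y z]; rewrite !inE.
- by move: (r (inl x)); rewrite inE.
- by move: (s (inl x) (inl y)); rewrite !inE.
- by move: (t (inl x) (inl y) (inl z)); rewrite !inE.
Qed.

Definition npart_mul (n : nat) (a b : npart n) : npart n :=
  NPart (mul_rel_equiv a b).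

Definition point_index (n : nat) (x : point n) : 'I_n :=
  match x with inl i => i | inr i => i end.

Definition one_rel (n : nat) : {set point n * point n} :=
  [set p | point_index p.1 == point_index p.2].

Fact one_rel_equiv (n : nat) : is_equiv (one_rel n).
Proof.
apply/is_equivP; split=> [x|x y|x y z]; rewrite !inE //=; first by rewrite eq_sym.
by move=> /eqP->.
Qed.

Definition npart_one (n : nat) : npart n := NPart (one_rel_equiv n).

Definition star_rel (n : nat) (a : npart n) : {set point n * point n} :=
  [set p | (swap_point p.1, swap_point p.2) \in npart_rel a].

Fact star_rel_equiv (n : nat) (a : npart n) : is_equiv (star_rel a).
Proof.
have/is_equivP[r s t] := npart_equiv a.
apply/is_equivP; split=> [x|x y|x y z]; rewrite !inE //=; [exact: s | exact: t].
Qed.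

Definition star (n : nat) (a : npart n) : npart n := NPart (star_rel_equiv a).

Section MonoidLaws.
Variable n : nat.
Implicit Types (a b c : npart n) (x y z : point n) (P Q R : pred 'I_n).

Let side P Q x := match x with inl i => P i | inr i => Q i end.
Let invariant a P Q :=
  forall x y, (x, y) \in npart_rel a -> side P Q x -> side P Q y.

Let npart_ext a b :
  (forall x y, (x, y) \in npart_rel a <-> (x, y) \in npart_rel b) -> a = b.
Proof. by move=> ab; apply/val_inj/setP=> -[x y]; apply/idP/idP=> /ab. Qed.

Let npartP a x y :
  (x, y) \in npart_rel a <->
  (forall P Q, invariant a P Q -> side P Q x -> side P Q y).
Proof.
have/is_equivP[r s t] := npart_equiv a.
split=> [xy P Q|]; first exact.
move/(_ (fun i => (x, inl i) \in npart_rel a) (fun i => (x, inr i) \in npart_rel a)).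
have sideE z : side (fun i => (x, inl i) \in npart_rel a)
  (fun i => (x, inr i) \in npart_rel a) z = ((x, z) \in npart_rel a) by case: z.
rewrite !sideE; apply=> // u v uv; rewrite !sideE => xu; exact: t xu uv.
Qed.

Let stack_trans a b u v w :
  (u, v) \in stack a b -> (v, w) \in stack a b -> (u, w) \in stack a b.
Proof. by case/is_equivP: (generated_equivP
  ([set (upper p.1, upper p.2) | p in npart_rel a]
   :|: [set (lower p.1, lower p.2) | p in npart_rel b])) => _ _; apply. Qed.

Let stack_upper a b x y :
  (x, y) \in npart_rel a -> (upper x, upper y) \in stack a b.
Proof.
move=> xy; apply/(subsetP (generated_equiv_sub _)).
by rewrite inE; apply/orP; left; apply/imsetP; exists (x, y).
Qed.

Let stack_lower a b x y :
  (x, y) \in npart_rel b -> (lower x, lower y) \in stack a b.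
Proof.
move=> xy; apply/(subsetP (generated_equiv_sub _)).
by rewrite inE; apply/orP; right; apply/imsetP; exists (x, y).
Qed.

Let invariant_mul a b P R :
  invariant (npart_mul a b) P R <->
  exists Q, invariant a P Q /\ invariant b Q R.
Proof.
split=> [inv | [Q [ia ib]] x y].
  pose Q i := [exists z, side P R z && ((inl z, inr i) \in stack a b)].
  have refl u : (u, u) \in stack a b.
    by rewrite inE connect0.
  have inP z z' : side P R z -> (inl z, inl z') \in stack a b -> side P R z'.
    by move=> zz' Sz; apply: inv zz'; rewrite inE.
  exists Q; split=> x y xy.
    have yy z : side P R z -> (inl z, upper x) \in stack a b -> side P Q y.
      move=> Sz zx; have := stack_trans zx (stack_upper b xy).
      case: y {xy} => j /= zy; first exact: (inP z (inl j)).
      by apply/existsP; exists z; rewrite Sz.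
    case: x yy {xy} => i yy /= Si; first exact: (yy (inl i)).
    by case/existsP: Si => z /andP[]; apply: yy.
  have yy z : side P R z -> (inl z, lower x) \in stack a b -> side Q R y.
    move=> Sz zx; have := stack_trans zx (stack_lower a xy).
    case: y {xy} => j /= zy; last exact: (inP z (inr j)).
    by apply/existsP; exists z; rewrite Sz.
  case: x yy {xy} => i yy /= Si; last exact: (yy (inr i)).
  by case/existsP: Si => z /andP[]; apply: yy.
pose C (u : point3 n) := match u with inl x => side P R x | inr i => Q i end.
have upC z : C (upper z) = side P Q z by case: z.
have loC z : C (lower z) = side Q R z by case: z.
pose e := [set p | C p.1 == C p.2].
rewrite inE => xy.
suff /subsetP/(_ _ xy): stack a b \subset e by rewrite inE => /eqP /= ->.
apply: generated_equiv_min.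
  apply/is_equivP; split=> [?|??|???]; rewrite !inE //=; first by rewrite eq_sym.
  by move=> /eqP->.
have/is_equivP[_ sa _] := npart_equiv a; have/is_equivP[_ sb _] := npart_equiv b.
apply/subsetP=> p /setUP[]/imsetP[[u v] uv ->]; rewrite inE /=.
  by rewrite !upC; apply/eqP; apply/idP/idP; apply: ia; [|apply: sa].
by rewrite !loC; apply/eqP; apply/idP/idP; apply: ib; [|apply: sb].
Qed.

Let invariant_one P Q : invariant (npart_one n) P Q <-> P =1 Q.
Proof.
split=> [inv i|PQ x y].
  by apply/idP/idP; [apply: (inv (inl i) (inr i)) | apply: (inv (inr i) (inl i))];
    rewrite inE.
have sE z : side P Q z = P (point_index z) by case: z => //= i; rewrite PQ.
by rewrite inE !sE => /eqP /= ->.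
Qed.

Let invariant_star a P Q : invariant (star a) P Q <-> invariant a Q P.
Proof.
have sw R S x : side R S (swap_point x) = side S R x by case: x.
have swK x : swap_point (swap_point x) = x by case: x.
split=> inv x y xy; rewrite -[side _ _ x]sw -[side _ _ y]sw; apply: inv.
  by rewrite inE /= !swK.
by move: xy; rewrite inE.
Qed.

Let inv_ext a b :
  (forall P Q, invariant a P Q <-> invariant b P Q) -> a = b.
Proof.
by move=> ab; apply: npart_ext => x y; split=> /npartP xy; apply/npartP=> P Q;
  move/ab; apply: xy.
Qed.

Fact npart_mulA : associative (@npart_mul n).
Proof.
move=> a b c; apply: inv_ext => P Q.
split=> /invariant_mul[R [h1 h2]]; apply/invariant_mul.
  by case/invariant_mul: h2 => S [h3 h4]; exists S; split=> //;
    apply/invariant_mul; exists R.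
by case/invariant_mul: h1 => S [h3 h4]; exists S; split=> //;
  apply/invariant_mul; exists R.
Qed.

Fact npart_mul1 : left_id (npart_one n) (@npart_mul n).
Proof.
move=> a; apply: inv_ext => P Q; split=> [/invariant_mul[R []]|ia].
  move=> /invariant_one PR ia x y xy.
  have sE z : side P Q z = side R Q z by case: z => //= i; rewrite PR.
  by rewrite !sE; apply: ia.
by apply/invariant_mul; exists P; split=> //; apply/invariant_one.
Qed.

Fact starK : involutive (@star n).
Proof.
by move=> a; apply: inv_ext => P Q; split=> [/invariant_star/invariant_star|ia] //;
  apply/invariant_star/invariant_star.
Qed.

Fact starM : {morph @star n : a b / npart_mul a b >-> npart_mul b a}.
Proof.
move=> a b; apply: inv_ext => P Q; split.
  case/invariant_star/invariant_mul=> R [h1 h2].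
  by apply/invariant_mul; exists R; split; apply/invariant_star.
case/invariant_mul=> R [h1 h2].
by apply/invariant_star/invariant_mul; exists R; split; apply/invariant_star.
Qed.

End MonoidLaws.

(* In the star-monoid of partitions, [a * b] is the product of partitions; the  *)
(* library writes the involution [star a] as [a^-1], although it is not in      *)
(* general an inverse of [a].                                                 *)
HB.instance Definition _ (n : nat) :=
  isStarMonoid.Build (npart n)
    (@npart_mulA n) (@npart_mul1 n) (@starK n) (@starM n).

Definition block (n : nat) (a : npart n) (x : point n) : {set point n} :=
  [set y | (x, y) \in npart_rel a].

Definition blocks (n : nat) (a : npart n) : {set {set point n}} :=
  [set block a x | x : point n].

Definition transverse (n : nat) (B : {set point n}) : bool :=
  [exists i, inl i \in B] && [exists j, inr j \in B].

Definition npart_rank (n : nat) (a : npart n) : nat :=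
  #|[set B in blocks a | transverse B]|.

Definition npart_ker (n : nat) (a : npart n) : {set 'I_n * 'I_n} :=
  [set p | (inl p.1, inl p.2) \in npart_rel a].

Definition npart_coker (n : nat) (a : npart n) : {set 'I_n * 'I_n} := npart_ker (star a).

Definition trivial_equiv (T : finType) (e : {set T * T}) : bool :=
  e == [set p | p.1 == p.2].

Definition PB (n : nat) : {set npart n} :=
  [set a | [forall B in blocks a, #|B| <= 2]].

(* The group of units of the partition monoid. *)
Definition npart_sym (n : nat) : {set npart n} :=
  [set a | [forall B in blocks a,
              [exists i, exists j, B == [set inl i; inr j]]]].

(* Below S, assumed to be a submonoid of an ambient finite monoid T, is the     *)
(* monoid under study; as 1 belongs to S, the principal ideals generated by x   *)
(* are S x, x S and S x S.                                                    *)
Section Semigroups.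
Variables (T : finStarMonoidType) (S : {set T}).
Implicit Types (x y : T) (M J U : {set T}).

Definition subsemigroup M : bool :=
  [&& M != set0, M \subset S & M * M \subset M].

Definition maximal_subsemigroup M : bool :=
  maxset [pred X : {set T} | subsemigroup X && (X \proper S)] M.

Definition subgroup U : bool :=
  [&& subsemigroup U, 1 \in U
    & [forall x in U, exists y in U, (x * y == 1) && (y * x == 1)]].

Definition maximal_subgroup U : bool :=
  maxset [pred X : {set T} | subgroup X && (X \proper S)] U.

Definition semilattice : Prop :=
  [/\ S * S \subset S, {in S &, forall x y, x * y = y * x}
    & {in S, forall x, x * x = x}].

Definition Lclass x : {set T} := [set y in S | S * [set y] == S * [set x]].
Definition Rclass x : {set T} := [set y in S | [set y] * S == [set x] * S].
Definition Hclass x : {set T} := Lclass x :&: Rclass x.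
Definition Jclass x : {set T} :=
  [set y in S | S * [set y] * S == S * [set x] * S].

Definition regular_set J : Prop :=
  forall x, x \in J -> exists2 y, y \in S & x * y * x = x.

Definition arises_from_regular M J : Prop :=
  [/\ maximal_subsemigroup M, exists2 x, x \in S & J = Jclass x,
      regular_set J & S :\: M \subset J].

Definition typeM1 M : Prop :=
  exists2 J, arises_from_regular M J & M :&: J = set0.

Definition typeM3 M : Prop :=
  exists2 J, arises_from_regular M J &
    exists A : {set T},
      [/\ A \subset J, A != set0 & M :&: J = \bigcup_(x in A) Lclass x].

Definition typeM4 M : Prop :=
  exists2 J, arises_from_regular M J &
    exists A : {set T},
      [/\ A \subset J, A != set0 & M :&: J = \bigcup_(x in A) Rclass x].

Definition typeM5 M : Prop :=
  exists2 J, arises_from_regular M J &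
    forall x, x \in J -> M :&: Hclass x != set0.

End Semigroups.

Definition max_a (n : nat) (U : {set npart n}) : {set npart n} :=
  (PB n :\: npart_sym n) :|: U.

Definition max_b (n : nat) : {set npart n} :=
  PB n :\: [set a in PB n | npart_rank a == n - 1].

Definition max_c (n : nat) : {set npart n} :=
  PB n :\: [set a in PB n | (npart_rank a == n - 2)
                           && ~~ trivial_equiv (npart_ker a)].

Definition max_d (n : nat) : {set npart n} :=
  PB n :\: [set a in PB n | (npart_rank a == n - 2)
                           && ~~ trivial_equiv (npart_coker a)].

(* Main.v *)
Require Import Defs.
From mathcomp Require Import all_boot all_fingroup all_solvable.

(** Multiplying partitions never increases the rank, so the singular part of the
    monoid is an ideal; moreover the blocks of [a] among upper points are still
    blocks of [a * b] ([mate_mul_upper]), and dually. Hence [max_b], [max_c]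
    and [max_d] are subsemigroups ([max_b_mul], [max_c_mul], [max_d_mul]), and so
    is the singular part together with any subgroup of units.

    Conversely, write [e] for the partial identity of rank n - 1 missing the index
    i, and [h] for the projection of rank n - 2 with an upper and a lower pair on
    i and j. The units together with all such [e] and [h] generate the monoid
    ([hooks_generate]): a partition with an upper pair and a lower pair is [h]
    times a partition of larger rank ([pair_factor]), and two singletons can be
    turned into a pair at the cost of a factor [e] ([singleton_factor]). Up to
    units, a partition of rank n - 1 is some [e], and one of rank n - 2 with an
    upper pair is [h] or [h e], so in the presence of the units and [e] it
    yields [h e]; dually a lower pair yields [e h], and (h e)(e h) = h. Therefore
    a subsemigroup that contains the units, an element of rank n - 1, and elements
    of rank n - 2 with an upper pair and with a lower pair, is everything
    ([generate]). So a maximal subsemigroup containing all units is contained in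
    [max_b], [max_c] or [max_d], and these are maximal; a maximal subsemigroup that omits a unit
    contains the singular part, and is determined by a maximal subgroup of the
    group of units.

    The technical point is the computation of products. An element of the partial
    Brauer monoid is an involution [mate] on its points, and in the stacked diagram
    the two involutions split the points into paths and cycles; the mate of an
    outer point in the product is the other end of its path
    ([exits_component], [mate_mul]). This also shows that blocks of a product have
    at most two points ([PB_mul]). *)

Set Implicit Arguments.
Unset Strict Implicit.
Unset Printing Implicit Defensive.

Local Open Scope group_scope.

(** * Components of two involutions *)

Section TwoInvolutions.

Variables (T : finType) (sg mu : T -> T).
Hypotheses (sgK : involutive sg) (muK : involutive mu).

(** [exits s t]: the walk from [s] that applies [mu], then [sg], then [mu], and
    so on, meets its first fixed point of [sg] after a [mu]-step at [t]. *)
Inductive exits : T -> T -> Prop :=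
| ExitNow s : sg (mu s) = mu s -> exits s (mu s)
| ExitLater s t : sg (mu s) != mu s -> exits (sg (mu s)) t -> exits s t.

(** The permutation [sg \o mu] has finite order, so the walk comes back to [s],
    which is a fixed point of [sg]; it therefore meets a first one. *)
Lemma exits_total s : sg s = s -> exists t, exits s t.
Proof.
move=> ss; pose step := sg \o mu.
have step_inj : injective step by apply: inj_comp; apply: inv_inj.
have [k Ek] : exists k, iter k.+1 step s = s.
  by exists (fingraph.order step s).-1; rewrite prednK ?fingraph.order_gt0 // iter_order.
have {Ek}: sg (iter k.+1 step s) = iter k.+1 step s by rewrite Ek.
elim: k s {ss} => [|k IHk] s; first by rewrite /= sgK => Es; exists (mu s); constructor.
rewrite iterSr => /IHk[t st].
have [Es|neq] := eqVneq (sg (mu s)) (mu s); first by exists (mu s); constructor.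
by exists t; apply: ExitLater.
Qed.

Lemma exits_fixed s t : exits s t -> sg t = t.
Proof. by elim. Qed.

(** The points visited between [s] and [t] form a set closed under both
    involutions: a component is a path whose ends are fixed by [sg]. *)
Lemma exits_component s t : sg s = s -> exits s t ->
  exists C : {set T},
    [/\ s \in C, forall u, u \in C -> mu u \in C, forall u, u \in C -> sg u \in C
      & forall u, u \in C -> sg u = u -> u = s \/ u = t].
Proof.
move=> ss st.
(* A tail of the walk visits a set that is closed under [sg] except possibly at
   its starting point; this weaker claim is the one that goes by induction. *)
suff [C [sC muC sgC fixC]] : exists C : {set T},
    [/\ s \in C, forall u, u \in C -> mu u \in C,
        forall u, u \in C -> u != s -> sg u \in C
      & forall u, u \in C -> sg u = u -> u = s \/ u = t].
  exists C; split=> // u uC; have [->|] := eqVneq u s; first by rewrite ss.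
  exact: sgC.
elim: st => {s t ss} [s sgmu|s t neq _ [C [sC muC sgC fixC]]].
  exists [set s; mu s]; split=> [|u|u|u]; rewrite ?inE ?eqxx //.
  - by case/orP=> /eqP->; rewrite ?muK eqxx ?orbT.
  - by case/orP=> /eqP->; rewrite ?eqxx // ?sgmu ?eqxx ?orbT.
  - by case/orP=> /eqP->; [left | right].
exists ([set s; mu s] :|: C); split=> [|u|u|u]; rewrite ?inE ?eqxx //.
- by case/orP=> [/orP[]/eqP->|/muC->]; rewrite ?muK ?eqxx ?orbT.
- case/orP=> [/orP[]/eqP->|uC us]; rewrite ?eqxx ?sC ?orbT //.
  have [->|neq'] := eqVneq u (sg (mu s)); first by rewrite sgK eqxx !orbT.
  by rewrite sgC ?orbT.
- case/orP=> [/orP[]/eqP->|uC su]; first by left.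
    by move=> E; rewrite E eqxx in neq.
  case: (fixC u uC su) => [Eu|]; last by right.
  by move: su neq; rewrite Eu sgK => <-; rewrite eqxx.
Qed.

End TwoInvolutions.

(** * Elements of the partial Brauer monoid as involutions *)

Section Mates.

Variable n : nat.
Implicit Types (a b : npart n) (x y z : point n) (i j : 'I_n).

Lemma npart_refl a x : (x, x) \in npart_rel a.
Proof. by case/is_equivP: (npart_equiv a). Qed.

Lemma npart_symm a x y : (x, y) \in npart_rel a -> (y, x) \in npart_rel a.
Proof. by case/is_equivP: (npart_equiv a) => _ + _; apply. Qed.

(** The other point of the block of [x], or [x] itself when [x] is a singleton
    block. On blocks with more than two points the value is an arbitrary
    choice. *)
Definition mate a x : point n := odflt x [pick y | (y != x) && ((x, y) \in npart_rel a)].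

Lemma mem_PB a :
  (forall x y z, (x, y) \in npart_rel a -> (x, z) \in npart_rel a ->
     [|| y == x, z == x | y == z]) -> a \in PB n.
Proof.
move=> small; rewrite inE; apply/forall_inP=> _ /imsetP[x _ ->].
rewrite (cardsD1 x) inE npart_refl add1n ltnS.
apply/card_le1P => y; rewrite !inE => /andP[yx xy] z; rewrite !inE.
apply/andP/eqP=> [[zx xz]|->]; last by [].
by move: (small x y z xy xz); rewrite (negbTE yx) (negbTE zx) => /eqP.
Qed.

Lemma PB_rel a x y : a \in PB n ->
  ((x, y) \in npart_rel a) = (y == x) || (y == mate a x).
Proof.
rewrite inE => /forall_inP/(_ (block a x)) small; rewrite /mate.
have [->|yx] := eqVneq y x; first by rewrite npart_refl.
case: pickP => [z /andP[zx xz]|none] /=; last by rewrite (negbTE yx) -(none y) yx.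
apply/idP/eqP=> [xy|->] //.
have {}small : #|block a x| <= 2 by apply/small/imset_f.
apply/eqP; apply: contraLR small => yz; rewrite -ltnNge.
have : [set x; y; z] \subset block a x.
  by apply/subsetP=> u; rewrite !inE => /orP[/orP[]|]/eqP-> //; exact: npart_refl.
move/subset_leq_card; apply: leq_trans.
by rewrite -setUA cardsU1 cards2 !inE negb_or !(eq_sym x) yx zx yz.
Qed.

Lemma rel_mate a x : (x, mate a x) \in npart_rel a.
Proof.
rewrite /mate; case: pickP => [y /andP[]|] //= _; exact: npart_refl.
Qed.

Lemma mateE a (f : point n -> point n) :
  (forall x y, ((x, y) \in npart_rel a) = (y == x) || (y == f x)) -> mate a =1 f.
Proof.
move=> fE x; rewrite /mate; case: pickP => [y|none] /=.
  by rewrite fE => /andP[/negbTE-> /eqP].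
by move: (none (f x)); rewrite fE eqxx orbT andbT => /negbFE/eqP.
Qed.

Lemma mateK a : a \in PB n -> involutive (mate a).
Proof.
move=> aPB x; have := npart_symm (rel_mate a x); rewrite PB_rel //.
case/orP=> /eqP E; last by rewrite -E.
by rewrite -E.
Qed.

Lemma mate_ext a b : a \in PB n -> b \in PB n -> mate a =1 mate b -> a = b.
Proof.
move=> aPB bPB ab; apply/val_inj/setP=> -[x y].
by rewrite /= !PB_rel // ab.
Qed.

Definition involution_rel (f : point n -> point n) : {set point n * point n} :=
  [set p | (p.2 == p.1) || (p.2 == f p.1)].

Fact involution_rel_equiv f : involutive f -> is_equiv (involution_rel f).
Proof.
move=> fK; apply/is_equivP; split=> [x|x y|x y z]; rewrite !inE /= ?eqxx //.
  by case/orP=> /eqP->; rewrite ?eqxx // fK eqxx orbT.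
by case/orP=> /eqP-> // /orP[]/eqP->; rewrite ?eqxx ?orbT // fK eqxx.
Qed.

(** The partition whose blocks are the orbits of an involution. *)
Definition of_involution f (fK : involutive f) : npart n :=
  NPart (involution_rel_equiv fK).

Lemma mate_of_involution f (fK : involutive f) : mate (of_involution fK) =1 f.
Proof. by apply: mateE => x y; rewrite inE. Qed.

Lemma of_involution_PB f (fK : involutive f) : of_involution fK \in PB n.
Proof.
apply: mem_PB => x y z; rewrite !inE /=.
by case/orP=> /eqP->; rewrite ?eqxx // => /orP[]/eqP->; rewrite ?eqxx ?orbT.
Qed.

(** In the stacked diagram of [a] above [b], a state is a point of [a] ([inl]) or
    a point of [b] ([inr]). The lower points of [a] are the upper points of [b]:
    [turn] exchanges the two descriptions of such a middle point, and fixes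
    exactly the states that are outer points. *)
Definition turn (s : point n + point n) : point n + point n :=
  match s with inl (inr i) => inr (inl i) | inr (inl i) => inl (inr i) | _ => s end.

(** Crossing a block of [a] or of [b]. *)
Definition move_along (f g : point n -> point n) (s : point n + point n) :
    point n + point n :=
  match s with inl x => inl (f x) | inr x => inr (g x) end.

(** The state at which a walk from an outer point starts. *)
Definition enter (x : point n) : point n + point n :=
  match x with inl _ => inl x | inr _ => inr x end.

(** The point of the stacked diagram that a state describes. *)
Definition place (s : point n + point n) : point3 n :=
  match s with inl x => upper x | inr x => lower x end.

Lemma turnK : involutive turn.
Proof. by case=> [[]|[]]. Qed.

Lemma move_alongK f g : involutive f -> involutive g -> involutive (move_along f g).
Proof. by move=> fK gK [x|x] /=; rewrite ?fK ?gK. Qed.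

Lemma place_turn s : place (turn s) = place s.
Proof. by case: s => [[]|[]]. Qed.

Lemma place_enter x : place (enter x) = inl x.
Proof. by case: x. Qed.

Lemma turn_enter x : turn (enter x) = enter x.
Proof. by case: x. Qed.

Lemma turn_fixed s : turn s = s -> exists x, s = enter x.
Proof. by case: s => [[i|i]|[i|i]] // _; [exists (inl i) | exists (inr i)]. Qed.

(** Starting at the state [s], alternately crossing blocks and changing layer, the
    first outer point reached is [x]. *)
Definition leads a b s x := exits turn (move_along (mate a) (mate b)) s (enter x).

Lemma leads_upper a b x i : mate a x = inl i -> leads a b (inl x) (inl i).
Proof.
move=> E; have := @ExitNow _ turn (move_along (mate a) (mate b)) (inl x).
by rewrite /leads /= E; apply.
Qed.

Lemma leads_down a b x i y :
  mate a x = inr i -> leads a b (inr (inl i)) y -> leads a b (inl x) y.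
Proof. by move=> E l; apply: ExitLater; rewrite /= E. Qed.

Lemma leads_lower a b x i : mate b x = inr i -> leads a b (inr x) (inr i).
Proof.
move=> E; have := @ExitNow _ turn (move_along (mate a) (mate b)) (inr x).
by rewrite /leads /= E; apply.
Qed.

Lemma leads_up a b x i y :
  mate b x = inl i -> leads a b (inl (inr i)) y -> leads a b (inr x) y.
Proof. by move=> E l; apply: ExitLater; rewrite /= E. Qed.

Lemma stack_move a b s :
  (place s, place (move_along (mate a) (mate b) s)) \in stack a b.
Proof.
apply/(subsetP (generated_equiv_sub _)); rewrite inE; apply/orP.
case: s => x /=; [left | right]; apply/imsetP.
  by exists (x, mate a x); first exact: rel_mate.
by exists (x, mate b x); first exact: rel_mate.
Qed.

Lemma stack_leads a b s x : leads a b s x -> (place s, inl x) \in stack a b.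
Proof.
have/is_equivP[_ _ tr] : is_equiv (stack a b) by exact: generated_equivP.
rewrite -place_enter /leads; elim=> {s x} [s t|s t _ _]; first exact: stack_move.
rewrite place_turn; apply: tr; exact: stack_move.
Qed.

(** The block of an outer point [x] in a product consists of [x] and of the first
    outer point on the walk from [x]. *)
Lemma mul_rel_leads a b x y z : a \in PB n -> b \in PB n ->
  leads a b (enter x) y ->
  ((x, z) \in npart_rel (a * b)) = (z == x) || (z == y).
Proof.
move=> aPB bPB xy; apply/idP/orP; last first.
  case=> /eqP->; first exact: npart_refl.
  by rewrite inE /=; have := stack_leads xy; rewrite place_enter.
have muK := move_alongK (mateK aPB) (mateK bPB).
have [C [xC muC sgC fixC]] := exits_component turnK muK (turn_enter x) xy.
rewrite inE /= => xz.
(* The visited states form a union of blocks of the stacked diagram, so their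
   indicator function [L] is constant on the blocks of the product. *)
pose L (u : point3 n) := match u with
  | inl w => enter w \in C | inr i => (inl (inr i) : point n + point n) \in C end.
have placeL s : L (place s) = (s \in C).
  case: s => [[i|i]|[i|i]] //=.
  by apply/idP/idP=> /sgC.
pose e := [set p | L p.1 == L p.2].
have : stack a b \subset e.
  apply: generated_equiv_min.
    apply/is_equivP; split=> [?|??|???]; rewrite !inE //=; first by rewrite eq_sym.
    by move=> /eqP->.
  apply/subsetP=> p /setUP[]/imsetP[[u v] uv ->]; rewrite inE /=.
    rewrite (placeL (inl u)) (placeL (inl v)).
    move: uv; rewrite PB_rel // => /orP[]/eqP->; first by [].
    by apply/eqP; apply/idP/idP => /muC; rewrite /= ?mateK.
  rewrite (placeL (inr u)) (placeL (inr v)).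
  move: uv; rewrite PB_rel // => /orP[]/eqP->; first by [].
  by apply/eqP; apply/idP/idP => /muC; rewrite /= ?mateK.
move/subsetP/(_ _ xz); rewrite inE /= xC => /eqP/esym/fixC[].
- exact: turn_enter.
- by case: (z) (x) => [?|?] [?|?] //= [->]; left.
- by case: (z) (y) => [?|?] [?|?] //= [->]; right.
Qed.

Lemma leads_total a b x : a \in PB n -> b \in PB n ->
  exists y, leads a b (enter x) y.
Proof.
move=> aPB bPB; have muK := move_alongK (mateK aPB) (mateK bPB).
have [t xt] := exits_total turnK muK (turn_enter x).
by have [y Ey] := turn_fixed (exits_fixed xt); exists y; rewrite /leads -Ey.
Qed.

Lemma PB_mul a b : a \in PB n -> b \in PB n -> a * b \in PB n.
Proof.
move=> aPB bPB; apply: mem_PB => x y z.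
have [t xt] := leads_total x aPB bPB.
rewrite !(mul_rel_leads _ aPB bPB xt).
by case/orP=> /eqP->; rewrite ?eqxx // => /orP[]/eqP->; rewrite ?eqxx ?orbT.
Qed.

Lemma mate_mul a b x y : a \in PB n -> b \in PB n ->
  leads a b (enter x) y -> mate (a * b) x = y.
Proof.
move=> aPB bPB xy; have abPB := PB_mul aPB bPB.
have E z := mul_rel_leads z aPB bPB xy.
have := E y; rewrite eqxx orbT PB_rel // => /orP[]/eqP Ey; last by rewrite Ey.
have := rel_mate (a * b) x; rewrite E Ey orbb; exact: eqP.
Qed.

End Mates.

(** * Permutations, hooks and their products *)

Section Generators.

Variable n : nat.
Implicit Types (a b c : npart n) (x y z : point n) (i j k l : 'I_n) (s t : 'S_n).

Lemma swap_pointK : involutive (@swap_point n).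
Proof. by case. Qed.

Lemma star_PB_rel a x y : a \in PB n ->
  ((x, y) \in npart_rel (star a)) = (y == x) || (y == swap_point (mate a (swap_point x))).
Proof.
move=> aPB; by rewrite inE PB_rel //= !(inv_eq swap_pointK) swap_pointK.
Qed.

Lemma mate_star a x : a \in PB n ->
  mate (star a) x = swap_point (mate a (swap_point x)).
Proof. by move=> aPB; move: x; apply: mateE => u v; apply: star_PB_rel. Qed.

Lemma PB_star a : a \in PB n -> star a \in PB n.
Proof.
move=> aPB; apply: mem_PB => x y z; rewrite !star_PB_rel //.
by case/orP=> /eqP->; rewrite ?eqxx // => /orP[]/eqP->; rewrite ?eqxx ?orbT.
Qed.

Definition perm_mate s x : point n :=
  match x with inl i => inr (s i) | inr j => inl (s^-1 j) end.

Fact perm_mateK s : involutive (perm_mate s).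
Proof. by case=> i /=; rewrite ?permK ?permKV. Qed.

(** The unit of the partition monoid given by the permutation [s]: its blocks are
    the pairs [inl i], [inr (s i)]. It is locked, like [hook] below, to keep
    unification from comparing products of generators by computation. *)
Definition perm_part s : npart n := locked (of_involution (perm_mateK s)).

Definition hook_mate i j x : point n :=
  match x with
  | inl k => if (k == i) || (k == j) then inl (tperm i j k) else inr k
  | inr k => if (k == i) || (k == j) then inr (tperm i j k) else inl k
  end.

Lemma tperm_pred2 i j k :
  (tperm i j k == i) || (tperm i j k == j) = (k == i) || (k == j).
Proof.
by case: tpermP => [->|->|//]; rewrite ?eqxx ?orbT.
Qed.

Fact hook_mateK i j : involutive (hook_mate i j).
Proof.
by case=> k /=; case: ifP => Ek /=; rewrite ?tperm_pred2 Ek // tpermK.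
Qed.

(** The projection with an upper block and a lower block on the indices [i] and
    [j], and a vertical block at every other index. For [i = j] it is the partial
    identity in which [i] is a singleton on both sides. *)
Definition hook i j : npart n := locked (of_involution (hook_mateK i j)).

Lemma perm_part_PB s : perm_part s \in PB n.
Proof. by rewrite /perm_part -lock of_involution_PB. Qed.

Lemma hook_PB i j : hook i j \in PB n.
Proof. by rewrite /hook -lock of_involution_PB. Qed.

Hint Resolve perm_part_PB hook_PB : core.

Lemma mate_perm s : mate (perm_part s) =1 perm_mate s.
Proof. by rewrite /perm_part -lock; apply: mate_of_involution. Qed.

Lemma mate_hook i j : mate (hook i j) =1 hook_mate i j.
Proof. by rewrite /hook -lock; apply: mate_of_involution. Qed.

Lemma mate_perm_mul s b x : b \in PB n ->
  mate (perm_part s * b) x =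
  match mate b (match x with inl i => inl (s i) | inr j => inr j end) with
  | inl k => inl (s^-1 k) | inr k => inr k
  end.
Proof.
move=> bPB; apply: mate_mul => //.
case: x => i.
  apply: leads_down; first by rewrite mate_perm.
  case E: (mate b _) => [k|k]; last exact: leads_lower.
  by apply: leads_up E _; apply: leads_upper; rewrite mate_perm.
rewrite /=; case E: (mate b _) => [k|k]; last exact: leads_lower.
by apply: leads_up E _; apply: leads_upper; rewrite mate_perm.
Qed.

Lemma perm_partM s t : perm_part (s * t) = perm_part s * perm_part t.
Proof.
apply: mate_ext => //; first exact: PB_mul.
by move=> x; rewrite mate_perm_mul // !mate_perm; case: x => i; rewrite /= ?invMg permM.
Qed.

Lemma perm_part1 : perm_part 1 = 1.
Proof.
apply/val_inj/setP=> -[x y]; rewrite /= PB_rel // mate_perm inE /= /perm_mate.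
by case: x y => i [] j; rewrite /point_index /= ?invg1 perm1 ?orbF ?orFb // eq_sym.
Qed.

Lemma PB1 : 1 \in PB n. Proof. by rewrite -perm_part1. Qed.

Lemma perm_partK s : perm_part s * perm_part s^-1 = 1.
Proof. by rewrite -perm_partM mulgV perm_part1. Qed.

Lemma perm_partVK s : perm_part s^-1 * perm_part s = 1.
Proof. by rewrite -perm_partM mulVg perm_part1. Qed.

Lemma perm_part_inj : injective perm_part.
Proof.
move=> s t E; apply/permP=> i; have := mate_perm s (inl i).
by rewrite E mate_perm => -[].
Qed.

Lemma star_perm s : star (perm_part s) = perm_part s^-1.
Proof.
apply: mate_ext => //; first exact: PB_star.
by move=> x; rewrite mate_star // !mate_perm; case: x => i //=; rewrite invgK.
Qed.

Lemma star_hook i j : star (hook i j) = hook i j.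
Proof.
apply: mate_ext => //; first exact: PB_star.
by move=> x; rewrite mate_star // !mate_hook; case: x => k //=; case: ifP.
Qed.

Lemma star_mul a b : star (a * b) = star b * star a.
Proof. exact: starM. Qed.

Lemma mate_mul_perm s b x : b \in PB n ->
  mate (b * perm_part s) x =
  match mate b (match x with inl i => inl i | inr j => inr (s^-1 j) end) with
  | inl k => inl k | inr k => inr (s k)
  end.
Proof.
move=> bPB; have := mate_perm_mul s^-1 (swap_point x) (PB_star bPB).
rewrite -star_perm -star_mul mate_star ?PB_mul // swap_pointK => E.
rewrite -[LHS]swap_pointK E; case: x {E} => i /=; rewrite mate_star //=;
  by case: (mate b _) => k //=; rewrite invgK.
Qed.

Lemma hook_perm i j s : hook i j * perm_part s = perm_part s * hook (s i) (s j).
Proof.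
apply: mate_ext; rewrite ?PB_mul // => x.
rewrite mate_perm_mul // mate_mul_perm // !mate_hook; case: x => k /=.
  rewrite !(inj_eq perm_inj); case: ifP => // _.
  by rewrite -inj_tperm ?permK //; exact: perm_inj.
rewrite -[in RHS](permKV s k) !(inj_eq perm_inj); case: ifP => _; last by rewrite permK.
by rewrite -inj_tperm //; exact: perm_inj.
Qed.

Lemma hook_conj i j s : perm_part s^-1 * hook i j * perm_part s = hook (s i) (s j).
Proof. by rewrite -mulgA hook_perm mulgA perm_partVK mul1g. Qed.

Lemma hook_conjV i j s : perm_part s * hook (s i) (s j) * perm_part s^-1 = hook i j.
Proof. by rewrite -hook_perm -mulgA perm_partK mulg1. Qed.

(** A hook can be split off on the left of [a]. The factor [b] agrees with [a] off
    the upper block of [i] and [j], except that it may attach points [x] to [i]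
    or [j]; the walk from such an [x] bounces on the lower block of the hook and
    ends where it should. *)
Lemma hook_factor a b i j : a \in PB n -> b \in PB n ->
  mate a (inl i) = inl j ->
  (forall x, x != inl i -> x != inl j -> mate b x = mate a x \/
     exists2 k, (k == i) || (k == j) &
       mate b x = inl k /\ mate b (inl (tperm i j k)) = mate a x) ->
  a = hook i j * b.
Proof.
move=> aPB bPB aij ab; apply: mate_ext; rewrite ?PB_mul // => x.
apply/esym/mate_mul => //.
have aji : mate a (inl j) = inl i by rewrite -aij mateK.
have a_in k : (k == i) || (k == j) -> mate a (inl k) = inl (tperm i j k).
  by case/orP=> /eqP->; rewrite ?tpermL ?tpermR.
have a_out l : mate a x = inl l -> x != inl i -> x != inl j ->
    (l == i) || (l == j) = false.
  move=> xl xi xj; apply: contraNF xi => /orP[] /eqP El.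
    by have := mateK aPB x; rewrite xl El aij => /eqP; rewrite eq_sym (negbTE xj).
  by rewrite -(mateK aPB x) xl El aji.
have side y : mate b y = mate a x -> x != inl i -> x != inl j ->
    leads (hook i j) b (inr y) (mate a x).
  move=> yx xi xj; case E: (mate a x) => [l|l]; last first.
    by apply: leads_lower; rewrite yx.
  apply: leads_up; first by rewrite yx; exact: E.
  by apply: leads_upper; rewrite mate_hook /= (a_out l).
have mid : x != inl i -> x != inl j -> leads (hook i j) b (inr x) (mate a x).
  move=> xi xj.
  case: (ab x xi xj) => [Ex|[k kij [xk kx]]]; first exact: side.
  apply: leads_up xk _; apply: leads_down (side _ kx xi xj).
  by rewrite mate_hook /= kij.
case: x ab a_out side mid => k ab a_out side mid /=; last exact: mid.
case kij : ((k == i) || (k == j)).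
  by rewrite a_in //; apply: leads_upper; rewrite mate_hook /= kij.
case/norP: (negbT kij) => ki kj.
apply: (@leads_down _ _ _ _ k); last exact: mid.
by rewrite mate_hook /= kij.
Qed.

(** Upper blocks persist under multiplication on the right. *)
Lemma mate_mul_upper a b i j : a \in PB n -> b \in PB n ->
  mate a (inl i) = inl j -> mate (a * b) (inl i) = inl j.
Proof. by move=> aPB bPB E; apply: mate_mul => //; apply: leads_upper. Qed.

Lemma hook_idem i j : hook i j * hook i j = hook i j.
Proof.
apply/esym/hook_factor => //; first by rewrite mate_hook /= eqxx tpermL.
by left.
Qed.

Lemma hook_singleton_hook i j : hook i j * hook i i * hook i j = hook i j.
Proof.
apply/esym; rewrite -mulgA; apply: hook_factor; rewrite ?PB_mul //.
  by rewrite mate_hook /= eqxx tpermL.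
have [->|neq] := eqVneq j i; first by rewrite !hook_idem; left.
move=> x xi xj; left; rewrite mate_hook; apply: mate_mul => //.
case: x xi xj => k ki kj /=.
  have -> : (k == i) || (k == j) = false by apply: negbTE; rewrite negb_or ki kj.
  apply: leads_down; first by rewrite mate_hook /= orbb (negbTE (ki : k != i)).
  by apply: leads_lower; rewrite mate_hook /= (negbTE (ki : k != i)) (negbTE (kj : k != j)).
case: ifP => kij; first by apply: leads_lower; rewrite mate_hook /= kij.
have ki' : k == i = false by apply: contraFF kij => ->.
apply: leads_up; first by rewrite mate_hook /= kij.
by apply: leads_upper; rewrite mate_hook /= ki'.
Qed.

End Generators.

(** * Rank, kernel and factorizations *)

Section Ranks.

Variable n : nat.
Implicit Types (a b c : npart n) (x y z : point n) (i j k l : 'I_n) (s t : 'S_n).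

Hint Resolve perm_part_PB hook_PB PB1 : core.

(** The upper points that lie in no transverse block; there are [n] minus the rank
    of them. *)
Definition udef a : {set 'I_n} := [set i | is_inl (mate a (inl i))].

Lemma udefP a i : reflect (exists j, mate a (inl i) = inl j) (i \in udef a).
Proof.
rewrite inE; case: (mate a _) => j /=; constructor; first by exists j.
by case.
Qed.

Lemma npart_rankE a : a \in PB n -> npart_rank a = #|~: udef a|.
Proof.
move=> aPB; rewrite /npart_rank.
have blockE x : block a x = [set x; mate a x].
  by apply/setP=> y; rewrite !inE PB_rel.
have -> : [set B in blocks a | transverse B] = [set block a (inl i) | i in ~: udef a].
  apply/setP=> B; rewrite inE; apply/andP/imsetP=> [[/imsetP[x _ ->]]|[i iU ->]].
    case/andP=> /existsP[i xi] /existsP[j xj]; exists i.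
      rewrite !inE; move: xi xj; rewrite !blockE !inE.
      have mx := mateK aPB x.
      case/orP=> /eqP Ei /orP[]/eqP Ej.
      - by rewrite -Ej in Ei.
      - by rewrite Ei -Ej.
      - by rewrite Ei mx -Ej.
      - by rewrite -Ej in Ei.
    move: xi; rewrite !blockE !inE => /orP[]/eqP-> //.
    by rewrite mateK // setUC.
  split; first exact: imset_f.
  move: iU; rewrite !inE; case E: (mate a _) => [//|j] _.
  by apply/andP; split; apply/existsP; [exists i | exists j];
    rewrite blockE !inE E eqxx ?orbT.
rewrite card_in_imset // => i j; rewrite !inE !blockE.
case Ei: (mate a _) => [//|k] _; case Ej: (mate a _) => [//|l] _.
by move/setP/(_ (inl i)); rewrite !inE eqxx /= orbF => /esym/eqP[].
Qed.

Lemma card_udef a : a \in PB n -> #|udef a| + npart_rank a = n.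
Proof. by move=> aPB; rewrite npart_rankE // cardsC card_ord. Qed.

Lemma npart_rank_le a : a \in PB n -> npart_rank a <= n.
Proof. by move/card_udef=> E; rewrite -[leqRHS]E leq_addl. Qed.

Lemma npart_rank_star a : a \in PB n -> npart_rank (star a) = npart_rank a.
Proof.
suff le b : b \in PB n -> npart_rank (star b) <= npart_rank b.
  move=> aPB; apply/eqP; rewrite eqn_leq le //=.
  by rewrite -{1}[a]starK le ?PB_star.
move=> bPB; rewrite !npart_rankE ?PB_star //.
have out i : i \in ~: udef (star b) -> mate b (inr i) = inl (point_index (mate b (inr i))).
  by rewrite !inE mate_star //=; case: (mate b _).
rewrite -(@card_in_imset _ _ (fun i => point_index (mate b (inr i)))).
  apply/subset_leq_card/subsetP=> _ /imsetP[i /out Ei ->].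
  by rewrite !inE -Ei mateK.
move=> i j /out Ei /out Ej Eij.
by have := mateK bPB (inr i); rewrite Ei Eij -Ej mateK // => -[].
Qed.

Lemma card_udef_star a : a \in PB n -> #|udef (star a)| = #|udef a|.
Proof.
move=> aPB; apply/eqP; rewrite -(eqn_add2r (npart_rank a)) card_udef //.
by rewrite -(npart_rank_star aPB) card_udef ?PB_star.
Qed.

Lemma udef_mul a b : a \in PB n -> b \in PB n -> udef a \subset udef (a * b).
Proof.
move=> aPB bPB; apply/subsetP=> i /udefP[j E]; apply/udefP; exists j.
exact: mate_mul_upper.
Qed.

Lemma npart_rank_mulL a b : a \in PB n -> b \in PB n ->
  npart_rank (a * b) <= npart_rank a.
Proof.
move=> aPB bPB; rewrite !npart_rankE ?PB_mul // subset_leq_card // setCS.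
exact: udef_mul.
Qed.

Lemma npart_rank_mulR a b : a \in PB n -> b \in PB n ->
  npart_rank (a * b) <= npart_rank b.
Proof.
move=> aPB bPB; rewrite -npart_rank_star ?PB_mul // star_mul.
by rewrite -(npart_rank_star bPB) npart_rank_mulL ?PB_star.
Qed.

Lemma mate_mul_lower a b i j : a \in PB n -> b \in PB n ->
  mate b (inr i) = inr j -> mate (a * b) (inr i) = inr j.
Proof. by move=> aPB bPB E; apply: mate_mul => //; apply: leads_lower. Qed.

Lemma mate_inj a : a \in PB n -> injective (mate a).
Proof. by move=> /mateK/inv_inj. Qed.

Lemma udef0_perm a : a \in PB n -> udef a = set0 -> exists s, a = perm_part s.
Proof.
move=> aPB U0.
have out i : mate a (inl i) = inr (point_index (mate a (inl i))).
  have := in_set0 i; rewrite -U0 inE.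
  by case: (mate a _).
have inj : injective (fun i => point_index (mate a (inl i))).
  move=> i j E; have : inl i = inl j :> point n.
    by apply: (mate_inj aPB); rewrite out [RHS]out E.
  by case.
exists (perm inj); apply: mate_ext => // -[i|i]; rewrite mate_perm /=.
  by rewrite permE.
rewrite -{1}(permKV (perm inj) i) permE -out mateK //.
Qed.

Lemma udef_perm s : udef (perm_part s) = set0.
Proof. by apply/setP=> i; rewrite !inE mate_perm. Qed.

Lemma udef_hook i j : udef (hook i j) = [set i; j].
Proof. by apply/setP=> k; rewrite !inE mate_hook /=; case: ifP. Qed.

Lemma rank_permP a : a \in PB n ->
  reflect (exists s, a = perm_part s) (npart_rank a == n).
Proof.
move=> aPB; apply: (iffP eqP) => [rk|[s ->]].
  apply: udef0_perm => //; apply/eqP; rewrite -cards_eq0.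
  by rewrite -(eqn_add2r (npart_rank a)) card_udef // rk.
by have := card_udef (perm_part_PB s); rewrite udef_perm cards0.
Qed.

Lemma npart_symP a : reflect (exists s, a = perm_part s) (a \in npart_sym n).
Proof.
rewrite inE; apply: (iffP forall_inP) => [sym|[s ->]].
  have aPB : a \in PB n.
    rewrite inE; apply/forall_inP=> B /sym/existsP[i /existsP[j /eqP->]].
    by rewrite cards2.
  apply: udef0_perm => //; apply/setP=> i; rewrite in_set0.
  apply/negP=> /udefP[j ij].
  have /sym/existsP[k /existsP[l /eqP/setP E]] : block a (inl i) \in blocks a by apply: imset_f.
  by have := E (inr l); rewrite !inE eqxx orbT PB_rel // ij.
move=> B /imsetP[x _ ->].
have blockE : block (perm_part s) x = [set x; perm_mate s x].
  by apply/setP=> y; rewrite !inE PB_rel // mate_perm.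
rewrite blockE; case: x {blockE} => i /=; apply/existsP.
  by exists i; apply/existsP; exists (s i).
by exists (s^-1 i); apply/existsP; exists i; rewrite setUC.
Qed.

Lemma npart_symE a : a \in PB n -> (a \in npart_sym n) = (npart_rank a == n).
Proof.
move=> aPB.
by apply/idP/idP => [/npart_symP/(rank_permP aPB)|/(rank_permP aPB)/npart_symP].
Qed.

Lemma npart_sym_PB : npart_sym n \subset PB n.
Proof. by apply/subsetP=> _ /npart_symP[s ->]; exact: perm_part_PB. Qed.

Lemma npart_kerP a : a \in PB n ->
  reflect (exists i j, i != j /\ mate a (inl i) = inl j) (~~ trivial_equiv (npart_ker a)).
Proof.
move=> aPB; apply: (iffP idP) => [|[i [j [ij E]]]].
  have [/existsP[i /existsP[j /andP[ij /eqP E]]] _|none] := boolP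
    [exists i, exists j, (i != j) && (mate a (inl i) == inl j)]; first by exists i, j.
  case/negP; apply/eqP/setP=> -[i j]; rewrite !inE /= PB_rel // eq_sym.
  apply/orP/idP => [[//|/eqP E]|]; last by move/eqP->; left.
  apply: contraNT none => ij; apply/existsP; exists i; apply/existsP; exists j.
  by rewrite ij E eqxx.
apply: contraNN ij => /eqP/setP/(_ (i, j)).
by rewrite !inE /= PB_rel // E eqxx orbT => /esym.
Qed.

Lemma npart_cokerP a : a \in PB n ->
  reflect (exists i j, i != j /\ mate a (inr i) = inr j) (~~ trivial_equiv (npart_coker a)).
Proof.
move=> aPB; apply: (iffP (npart_kerP (PB_star aPB))) => -[i [j [ij]]].
  rewrite mate_star //= => E; exists i, j; split=> //.
  by rewrite -(swap_pointK (mate _ _)) E.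
by move=> E; exists i, j; rewrite mate_star //= E.
Qed.

(** The involution [mate a] modified so as to exchange two of its fixed points. *)
Definition join_mate a x y z := if z == x then y else if z == y then x else mate a z.

Lemma join_mateK a x y : a \in PB n -> mate a x = x -> mate a y = y ->
  involutive (join_mate a x y).
Proof.
move=> aPB Ex Ey z; rewrite /join_mate.
have [-> //|zx] := eqVneq z x; first by rewrite eqxx; case: eqVneq.
have [-> //|zy] := eqVneq z y; first by rewrite eqxx.
have -> : mate a z == x = false by rewrite -Ex (inj_eq (mate_inj aPB)) (negbTE zx).
have -> : mate a z == y = false by rewrite -Ey (inj_eq (mate_inj aPB)) (negbTE zy).
exact: mateK.
Qed.

(** An upper singleton of [a] may be joined to any other singleton [z], at the cost
    of a factor [hook i i]. *)
Lemma singleton_factor a i z : a \in PB n ->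
  mate a (inl i) = inl i -> mate a z = z ->
  exists b, [/\ b \in PB n, a = hook i i * b & mate b =1 join_mate a (inl i) z].
Proof.
move=> aPB Ei Ez; exists (of_involution (join_mateK aPB Ei Ez)).
have bE := mate_of_involution (join_mateK aPB Ei Ez).
split=> //; first exact: of_involution_PB.
apply: hook_factor => //; first exact: of_involution_PB.
move=> x xi _; rewrite !bE /join_mate (negbTE xi).
have [->|_] := eqVneq x z; last by left.
by right; exists i; rewrite ?eqxx // tperm1 perm1 bE /join_mate eqxx Ez.
Qed.

Lemma defect1_factor a : a \in PB n -> #|udef a| = 1%N ->
  exists i s, a = hook i i * perm_part s.
Proof.
move=> aPB /eqP/cards1P[i U1].
have /eqP/cards1P[k L1] : #|udef (star a)| = 1%N by rewrite card_udef_star // U1 cards1.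
have Ei : mate a (inl i) = inl i.
  have /udefP[j E] : i \in udef a by rewrite U1 inE.
  have : j \in udef a by apply/udefP; exists i; rewrite -E mateK.
  by rewrite U1 inE => /eqP Ej; rewrite E Ej.
have Ek : mate a (inr k) = inr k.
  have /udefP[j] : k \in udef (star a) by rewrite L1 inE.
  rewrite mate_star //= => E'; have E : mate a (inr k) = inr j.
    by rewrite -(swap_pointK (mate _ _)) E'.
  have : j \in udef (star a) by apply/udefP; exists k; rewrite mate_star //= -E mateK.
  by rewrite L1 inE => /eqP Ej; rewrite E Ej.
have [b [bPB Ea bE]] := singleton_factor aPB Ei Ek.
have [s Eb] : exists s, b = perm_part s.
  apply: udef0_perm => //; apply/setP=> m; rewrite in_set0 inE bE /join_mate /=.
  case: eqVneq => // mi; have : m \notin udef a by rewrite U1 inE.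
  by rewrite inE; apply: contraNF.
by exists i, s; rewrite Ea Eb.
Qed.

(** The identity when [a] has an upper pair, and [hook i i] otherwise: as a left
    factor, [hook i i] splits an upper pair at [i] into two singletons. *)
Definition ker_fix a i : npart n := if trivial_equiv (npart_ker a) then hook i i else 1.

(** When at least two upper points are not in transverse blocks, an upper pair can
    be found, or created from two singletons. *)
Lemma upper_pair a : a \in PB n -> 1 < #|udef a| ->
  exists b i j, [/\ b \in PB n, a = ker_fix a i * b, i != j /\ mate b (inl i) = inl j,
    udef b = udef a & forall k, mate b (inr k) = mate a (inr k)].
Proof.
move=> aPB /card_gt1P[i [j [iU jU ij]]]; rewrite /ker_fix.
have [tr|] := boolP (trivial_equiv (npart_ker a)); last first.
  case/(npart_kerP aPB)=> k [l kl]; exists a, k, l; split=> //.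
  by rewrite mul1g.
have single k : k \in udef a -> mate a (inl k) = inl k.
  case/udefP=> l E; have [kl|kl] := eqVneq k l; first by rewrite E kl.
  by move: tr; apply: contraTeq => _; apply/(npart_kerP aPB); exists k, l.
have [b [bPB Ea bE]] := singleton_factor aPB (single i iU) (single j jU).
exists b, i, j; split=> //; first by split=> //; rewrite bE /join_mate eqxx.
apply/setP=> k; rewrite !inE bE /join_mate.
have [[->]|_] := eqVneq (inl k) (inl i : point n); first by rewrite single.
by have [[->]|_] := eqVneq (inl k) (inl j : point n); first by rewrite single.
Qed.

Lemma lower_pair a : a \in PB n -> 1 < #|udef a| ->
  exists b i j, [/\ b \in PB n, a = b * ker_fix (star a) i, i != j /\ mate b (inr i) = inr j,
    udef b = udef a & forall k, mate b (inl k) = mate a (inl k)].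
Proof.
move=> aPB gt1; have [|b [i [j [bPB Ea [ij Eij] _ bE]]]] := upper_pair (PB_star aPB).
  by rewrite card_udef_star.
have E k : mate (star b) (inl k) = mate a (inl k).
  by rewrite mate_star //= bE mate_star //= swap_pointK.
exists (star b), i, j; split=> //; first exact: PB_star.
- apply: (can_inj (@starK n)); rewrite star_mul starK Ea; congr (_ * _).
  rewrite -Ea /ker_fix; case: ifP => _; first by rewrite star_hook.
  by rewrite -(perm_part1 n) star_perm invg1.
- by split=> //; rewrite mate_star //= Eij.
by apply/setP=> k; rewrite !inE E.
Qed.

(** If [a] has both an upper pair and a lower pair, these four points can be
    reconnected into two transverse blocks. *)
Lemma pair_factor a i j k l : a \in PB n -> i != j -> k != l ->
  mate a (inl i) = inl j -> mate a (inr k) = inr l ->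
  exists b, [/\ b \in PB n, a = hook i j * b, mate b (inl i) = inr k
              & udef b = udef a :\ i :\ j].
Proof.
move=> aPB ij kl Eij Ekl.
have Eji : mate a (inl j) = inl i by rewrite -Eij mateK.
have Elk : mate a (inr l) = inr k by rewrite -Ekl mateK.
(* Conjugating [mate a] by the transposition of [inl j] and [inr k] turns the
   pairs i-j, k-l into i-k, j-l. *)
pose t := tperm (inl j : point n) (inr k).
have tK : involutive t by exact: tpermK.
have fK : involutive (fun x => t (mate a (t x))) by move=> x; rewrite tK mateK // tK.
have bE := mate_of_involution fK.
have tj : t (inl j) = inr k by rewrite /t tpermL.
have tk : t (inr k) = inl j by rewrite /t tpermR.
have ti : t (inl i) = inl i by apply: tpermD; rewrite // eq_sym.
have tl : t (inr l) = inr l by apply: tpermD.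
have bi : t (mate a (t (inl i))) = inr k by rewrite ti Eij.
have bj : t (mate a (t (inl j))) = inr l by rewrite tj Ekl.
have bl : t (mate a (t (inr l))) = inl j by rewrite tl Elk.
have bk : t (mate a (t (inr k))) = inl i by rewrite tk Eji.
have other x : x != inl i -> x != inl j -> x != inr k -> x != inr l ->
    t (mate a (t x)) = mate a x.
  move=> xi xj xk xl; rewrite /t (@tpermD _ (inl j) _ x) 1?eq_sym // tpermD //.
    by rewrite eq_sym -Eij (inj_eq (mate_inj aPB)).
  by rewrite eq_sym -Elk (inj_eq (mate_inj aPB)).
exists (of_involution fK); split=> //; first exact: of_involution_PB.
- apply: hook_factor => //; first exact: of_involution_PB.
  move=> x xi xj; rewrite bE.
  have [->|xk] := eqVneq x (inr k).
    by right; exists i; rewrite ?eqxx // bE tpermL bj -Ekl bk.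
  have [->|xl] := eqVneq x (inr l).
    by right; exists j; rewrite ?eqxx ?orbT // bE tpermR bi bl Elk.
  by left; rewrite other.
- by rewrite bE.
apply/setP=> m; rewrite !inE bE.
have [->|mj] := eqVneq m j; first by rewrite bj.
have [->|mi] := eqVneq m i; first by rewrite bi.
by rewrite other.
Qed.

Lemma defect_ge2_factor a : a \in PB n -> 1 < #|udef a| ->
  exists b i j k,
    [/\ b \in PB n, a = ker_fix a i * hook i j * b * ker_fix (star a) k,
        i != j, mate b (inl i) = inr k & (#|udef b|.+2 = #|udef a|)%N].
Proof.
move=> aPB gt1; have [b [i [j [bPB Ea [ij Eij] bU bE]]]] := upper_pair aPB gt1.
have gt1b : 1 < #|udef b| by rewrite bU.
have [c [k [l [cPB Eb [kl Ekl] cU cE]]]] := lower_pair bPB gt1b.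
have [|d [dPB Ec dik dU]] := pair_factor cPB ij kl _ Ekl; first by rewrite cE.
exists d, i, j, k; split=> //.
  suff -> : ker_fix (star a) k = ker_fix (star b) k.
    by rewrite -!mulgA (mulgA _ d) -Ec -Eb.
  rewrite /ker_fix; congr (if _ == _ then _ else _).
  by apply/setP=> p; rewrite !inE /= !PB_rel //= bE.
rewrite dU -bU -cU (cardsD1 i (udef c)) (cardsD1 j (udef c :\ i)) !inE.
have Eji : mate b (inl j) = inl i by rewrite -Eij mateK.
by rewrite (eq_sym j) ij !cE Eij Eji.
Qed.

End Ranks.

(** * Identities in monoids *)

Section MonoidIdentities.

Variable T : finStarMonoidType.
Implicit Types a h p q r s t : T.

Lemma conj_cancel p q a h :
  p * q = 1 -> q * a * p * (q * h * p) = q * (a * h) * p.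
Proof. by move=> pq; rewrite !mulgA -(mulgA _ p q) pq mulg1. Qed.

Lemma mulg_nested p q r s a : r * (p * a * q) * s = (r * p) * a * (q * s).
Proof. by rewrite !mulgA. Qed.

Lemma absorb p h a : h * p * h = h -> h * (p * (h * a)) = h * a.
Proof. by move=> hph; rewrite -{3}hph !mulgA. Qed.

Lemma sandwich_regular p q h s t : s * t = 1 -> h * p * h = h -> h * q * h = h ->
  p * h * q * s * (t * h) * (p * h * q * s) = p * h * q * s.
Proof.
by move=> st hph hqh; rewrite -!mulgA (mulgA s t) st mul1g (absorb _ hph) absorb.
Qed.

Lemma sandwich_recover p q h s t : s * t = 1 -> h * p * h = h -> h * q * h = h ->
  h * (p * h * q * s) * (t * h) = h.
Proof.
move=> st hph hqh.
by rewrite -!mulgA (mulgA s t) st mul1g (absorb _ hph) mulgA.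
Qed.

End MonoidIdentities.

(** * Generation of the partial Brauer monoid *)

Section Generation.

Variable n : nat.
Implicit Types (a b c : npart n) (x y z : point n) (i j k l : 'I_n) (s t : 'S_n).
Implicit Types (M U : {set npart n}) (G : {group 'S_n}).

Hint Resolve perm_part_PB hook_PB PB1 : core.

Lemma subsemigroupP (S M : {set npart n}) :
  reflect [/\ exists a, a \in M, M \subset S & {in M &, forall a b, a * b \in M}]
          (subsemigroup S M).
Proof.
apply: (iffP and3P) => -[/set0Pn ne sub cl]; split=> //.
  by move=> a b aM bM; apply/(subsetP cl)/mem_mulg.
by apply/subsetP=> _ /mulsgP[a b aM bM ->]; apply: cl.
Qed.

Lemma defect2_factor a : a \in PB n -> #|udef a| = 2 ->
  exists i j s, i != j /\
    a = ker_fix a i * hook i j * ker_fix (star a) i * perm_part s.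
Proof.
move=> aPB U2; have [|b [i [j [k [bPB Ea ij bik]]]]] := defect_ge2_factor aPB.
  by rewrite U2.
rewrite U2 => -[/eqP]; rewrite cards_eq0 => /eqP b0.
have [s Eb] := udef0_perm bPB b0; exists i, j, s; split=> //.
have {bik} Ek : k = s i by move: bik; rewrite Eb mate_perm => -[].
have fixE : b * ker_fix (star a) k = ker_fix (star a) i * perm_part s.
  by rewrite Eb Ek /ker_fix; case: ifP => _; rewrite ?hook_perm ?mulg1 ?mul1g.
by rewrite {1}Ea -mulgA fixE mulgA.
Qed.

Lemma perm_pair i j k l : i != j -> k != l -> exists s, s i = k /\ s j = l.
Proof.
move=> ij kl; exists (tperm i k * tperm (tperm i k j) l); rewrite !permM.
rewrite !tpermL (@tpermD _ _ l) // 1?eq_sym //.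
by rewrite eq_sym; apply: contraNneq ij => Ek; rewrite -(inj_eq (@perm_inj _ (tperm i k))) tpermL Ek.
Qed.

Section Closed.

Variable M : {set npart n}.
Hypotheses (mulM : {in M &, forall a b, a * b \in M}) (permM : forall s, perm_part s \in M).

Lemma ker_fix_closed : (forall i, hook i i \in M) -> forall a i, ker_fix a i \in M.
Proof. by move=> hM a i; rewrite /ker_fix; case: ifP; rewrite // -(perm_part1 n). Qed.

(** By induction on the number of upper points outside transverse blocks. *)
Lemma hooks_generate : (forall i j, hook i j \in M) -> PB n \subset M.
Proof.
move=> hM; apply/subsetP=> a; have [m] := ubnP #|udef a|.
elim: m a => // m IHm a; rewrite ltnS => le_m aPB.
have fixM := ker_fix_closed (fun i => hM i i).
have [gt1|] := ltnP 1 #|udef a|.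
  have [b [i [j [k [bPB Ea _ _ Eb]]]]] := defect_ge2_factor aPB gt1.
  have bM : b \in M by apply: IHm => //; apply: leq_trans le_m; rewrite -Eb.
  by rewrite Ea; do 3?[apply: mulM].
rewrite leq_eqVlt ltnS leqn0 cards_eq0 => /orP[/eqP U1|/eqP U0].
  by have [i [s ->]] := defect1_factor aPB U1; apply: mulM.
by have [s ->] := udef0_perm aPB U0.
Qed.

(** The heart of the classification: with the units, it takes one partition of
    rank [n - 1], one of rank [n - 2] with an upper pair, and one of rank [n - 2]
    with a lower pair to generate everything. *)
Lemma generate a b c :
  a \in M -> a \in PB n -> #|udef a| = 1%N ->
  b \in M -> b \in PB n -> #|udef b| = 2 -> ~~ trivial_equiv (npart_ker b) ->
  c \in M -> c \in PB n -> #|udef c| = 2 -> ~~ trivial_equiv (npart_coker c) ->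
  PB n \subset M.
Proof.
move=> aM aPB a1 bM bPB b2 bK cM cPB c2 cK.
have unit_r d s : d * perm_part s \in M -> d \in M.
  move=> dM; have := mulM dM (permM s^-1); by rewrite -mulgA perm_partK mulg1.
have hookJ i j s : hook (s i) (s j) = perm_part s^-1 * hook i j * perm_part s.
  by rewrite hook_conj.
have eM k : hook k k \in M.
  have [i [s Ea]] := defect1_factor aPB a1.
  have iM : hook i i \in M by apply: (unit_r _ s); rewrite -Ea.
  have -> : k = tperm i k i by rewrite tpermL.
  by rewrite hookJ; do 2?[apply: mulM].
(* Conjugation by units moves a product of two hooks on one pair of indices to any
   other pair. *)
have transport i j k l : i != j -> k != l ->
    (hook i j * hook i i \in M -> hook k l * hook k k \in M) /\
    (hook i i * hook i j \in M -> hook k k * hook k l \in M).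
  move=> ij kl; have [s [<- <-]] := perm_pair ij kl.
  have conjM d : d \in M -> perm_part s^-1 * d * perm_part s \in M.
    by move=> dM; apply: mulM (mulM _ _) _.
  have E i1 j1 i2 j2 : hook (s i1) (s j1) * hook (s i2) (s j2) =
      perm_part s^-1 * (hook i1 j1 * hook i2 j2) * perm_part s.
    by rewrite (hookJ i1) (hookJ i2); exact: conj_cancel (perm_partK s).
  by split=> dM; rewrite E; apply: conjM.
apply: hooks_generate => k l; have [<-//|kl] := eqVneq k l.
have heM : hook k l * hook k k \in M.
  have [i [j [s [ij Eb]]]] := defect2_factor bPB b2.
  apply: (proj1 (transport _ _ _ _ ij kl)).
  move: bM; rewrite Eb {1}/ker_fix (negbTE bK) mul1g => /unit_r; rewrite /ker_fix.
  by case: ifP => // _; rewrite mulg1 => hM; apply: mulM.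
have ehM : hook k k * hook k l \in M.
  have [i [j [s [ij Ec]]]] := defect2_factor cPB c2.
  apply: (proj2 (transport _ _ _ _ ij kl)).
  move: cM; rewrite Ec {2}/ker_fix (negbTE (cK : ~~ trivial_equiv (npart_ker (star c)))).
  rewrite mulg1 => /unit_r; rewrite /ker_fix.
  by case: ifP => // _; rewrite mul1g => hM; apply: mulM.
(* With e := hook k k and h := hook k l, the identities e e = e and h e h = h give
   (h e) (e h) = h. *)
have := mulM heM ehM.
by rewrite -!mulgA (mulgA (hook k k)) hook_idem mulgA hook_singleton_hook.
Qed.

End Closed.

Lemma rank_udef a d : a \in PB n -> d <= n -> (npart_rank a == n - d) = (#|udef a| == d).
Proof.
move=> aPB dn; have E := card_udef aPB; apply/eqP/eqP => [rk|Ud].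
  by apply/eqP; rewrite -(eqn_add2r (n - d)) subnKC // -rk E.
by have := congr1 (subn^~ d) E; rewrite /= Ud addKn.
Qed.

(** By finiteness, a subsemigroup that meets the group of units meets it in a
    subgroup. *)
Lemma sym_part_group M : {in M &, forall a b, a * b \in M} ->
  (exists2 a, a \in M & a \in npart_sym n) ->
  exists G : {group 'S_n}, M :&: npart_sym n = [set perm_part s | s in G].
Proof.
move=> mulM [a aM /npart_symP[s Ea]]; pose A := [set t | perm_part t \in M].
have AM : {in A &, forall s t, s * t \in A}.
  by move=> t u; rewrite !inE perm_partM; apply: mulM.
have AX t (m : nat) : t \in A -> t ^+ m.+1 \in A.
  by move=> tA; elim: m => [|m IHm]; rewrite ?expg1 // expgS AM.
have sA : s \in A by rewrite inE -Ea.
have grpA : group_set A.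
  apply/group_setP; split=> //; rewrite -(expg_order s) -(prednK (order_gt0 s)).
  exact: AX.
exists (Group grpA); apply/setP=> b; rewrite inE; apply/andP/imsetP.
  by case=> bM /npart_symP[t Eb]; exists t; rewrite // inE -Eb.
by case=> t; rewrite inE => tM ->; split=> //; apply/npart_symP; exists t.
Qed.

Lemma subgroupP U :
  reflect (exists G : {group 'S_n}, U = [set perm_part s | s in G]) (subgroup (npart_sym n) U).
Proof.
apply: (iffP and3P) => [[/subsemigroupP[_ sub mulU] U1 _]|[G ->]].
  have [|G EG] := sym_part_group mulU.
    by exists 1 => //; apply: (subsetP sub).
  by exists G; rewrite -EG; apply/esym/setIidPl.
have G1 : 1 \in [set perm_part s | s in G].
  by apply/imsetP; exists 1; rewrite ?group1 ?perm_part1.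
split=> //.
  apply/subsemigroupP; split; first by exists 1.
    by apply/subsetP=> _ /imsetP[s _ ->]; apply/npart_symP; exists s.
  by move=> _ _ /imsetP[s sG ->] /imsetP[t tG ->]; rewrite -perm_partM imset_f ?groupM.
apply/forall_inP=> _ /imsetP[s sG ->]; apply/exists_inP.
exists (perm_part s^-1); first by rewrite imset_f ?groupV.
by rewrite perm_partK perm_partVK eqxx.
Qed.

Lemma npart_sym_imset : npart_sym n = [set perm_part s | s in [set: 'S_n]].
Proof.
apply/setP=> a; apply/npart_symP/imsetP=> [[s ->]|[s _ ->]]; last by exists s.
by exists s.
Qed.

Lemma perm_imsetS (A B : {set 'S_n}) :
  ([set perm_part s | s in A] \subset [set perm_part s | s in B]) = (A \subset B).
Proof.
apply/idP/idP=> [/subsetP sub|]; last exact: imsetS.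
apply/subsetP=> s sA; have := sub _ (imset_f _ sA).
by rewrite mem_imset //; exact: perm_part_inj.
Qed.

Lemma maximal_subgroupP U :
  reflect (exists2 G : {group 'S_n}, maximal G [set: 'S_n] & U = [set perm_part s | s in G])
          (maximal_subgroup (npart_sym n) U).
Proof.
have properE (A : {set 'S_n}) :
    ([set perm_part s | s in A] \proper npart_sym n) = (A \proper [set: 'S_n]).
  by rewrite npart_sym_imset !properE !perm_imsetS.
apply: (iffP maxsetP) => [[/andP[/subgroupP[G ->]]]|[G]]; last first.
  rewrite /maximal => /maxgroupP[prG maxG] ->.
  split; first by rewrite /= properE prG andbT; apply/subgroupP; exists G.
  move=> B /andP[/subgroupP[H ->]]; rewrite properE perm_imsetS => prH GH.
  by rewrite (maxG H).
rewrite properE => prG maxG; exists G => //; rewrite /maximal; apply/maxgroupP; split=> // H prH GH.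
  apply/eqP; rewrite eqEsubset GH andbT -perm_imsetS (maxG [set perm_part s | s in H]) //.
    by rewrite /= properE prH andbT; apply/subgroupP; exists H.
  by rewrite perm_imsetS.
Qed.

End Generation.

(** * Maximal subsemigroups of degree at least two *)

Section Subsemigroups.

Variable n : nat.
Hypothesis n_gt1 : 1 < n.
Implicit Types (a b c : npart n) (x y z : point n) (i j k l : 'I_n) (s t : 'S_n).
Implicit Types (M U : {set npart n}) (G : {group 'S_n}).

Hint Resolve perm_part_PB hook_PB PB1 : core.

Let n_gt0 : 0 < n. Proof. exact: ltnW. Qed.

Lemma rank_n1_udef a : a \in PB n -> (npart_rank a == n - 1) = (#|udef a| == 1%N).
Proof. by move=> aPB; rewrite rank_udef. Qed.

Lemma rank_n2_udef a : a \in PB n -> (npart_rank a == n - 2) = (#|udef a| == 2).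
Proof. by move=> aPB; rewrite rank_udef. Qed.

Lemma mem_max_a U a : U \subset npart_sym n ->
  (a \in max_a U) = (a \in PB n) && ((a \in npart_sym n) ==> (a \in U)).
Proof.
move=> sub; rewrite in_setU in_setD andbC; have [aS|aS] /= := boolP (a \in npart_sym n).
  by rewrite (subsetP (npart_sym_PB n) _ aS) andbF.
rewrite !andbT; have [/(subsetP sub)|] := boolP (a \in U); last by rewrite orbF.
by rewrite (negbTE aS).
Qed.

Lemma mem_max_b a : (a \in max_b n) = (a \in PB n) && (npart_rank a != n - 1).
Proof. by rewrite in_setD inE; case: (a \in PB n); rewrite /= ?andbT ?andbF. Qed.

Lemma mem_max_c a : (a \in max_c n) =
  (a \in PB n) && ~~ ((npart_rank a == n - 2) && ~~ trivial_equiv (npart_ker a)).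
Proof. by rewrite in_setD inE; case: (a \in PB n); rewrite /= ?andbT ?andbF. Qed.

Lemma mem_max_d a : (a \in max_d n) =
  (a \in PB n) && ~~ ((npart_rank a == n - 2) && ~~ trivial_equiv (npart_coker a)).
Proof. by rewrite in_setD inE; case: (a \in PB n); rewrite /= ?andbT ?andbF. Qed.

Lemma PB_starE a : (star a \in PB n) = (a \in PB n).
Proof. by apply/idP/idP=> /PB_star; rewrite ?starK. Qed.

Lemma mem_max_d_star a : (a \in max_d n) = (star a \in max_c n).
Proof.
rewrite mem_max_c mem_max_d PB_starE; have [aPB|//] := boolP (a \in PB n).
by rewrite npart_rank_star.
Qed.

Lemma npart_symM a b : a \in PB n -> b \in PB n ->
  (a * b \in npart_sym n) = (a \in npart_sym n) && (b \in npart_sym n).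
Proof.
move=> aPB bPB; apply/idP/andP=> [|[/npart_symP[s ->] /npart_symP[t ->]]].
  rewrite !npart_symE ?PB_mul // => /eqP rk; split.
    by rewrite eqn_leq npart_rank_le //= -{1}rk npart_rank_mulL.
  by rewrite eqn_leq npart_rank_le //= -{1}rk npart_rank_mulR.
by apply/npart_symP; exists (s * t); rewrite perm_partM.
Qed.

Let rank_sym a : a \in npart_sym n -> npart_rank a = n.
Proof. by move=> aS; apply/eqP; rewrite -npart_symE // (subsetP (npart_sym_PB n)). Qed.

Let n_sub d : 0 < d -> (n == n - d) = false.
Proof. by move=> d0; rewrite gtn_eqF // ltn_subrL d0 n_gt0. Qed.

Lemma sym_sub_bcd : [/\ npart_sym n \subset max_b n, npart_sym n \subset max_c n
                      & npart_sym n \subset max_d n].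
Proof.
by split; apply/subsetP=> a aS; rewrite ?mem_max_b ?mem_max_c ?mem_max_d
  (subsetP (npart_sym_PB n)) //= rank_sym // n_sub.
Qed.

Lemma PB_subsemigroup M : M \subset PB n -> npart_sym n \subset M ->
  {in M &, forall a b, a * b \in M} -> subsemigroup (PB n) M.
Proof.
move=> sub symM mulM; apply/subsemigroupP; split=> //; exists (perm_part 1).
by apply/(subsetP symM)/npart_symP; exists 1.
Qed.

Lemma max_b_mul : {in max_b n &, forall a b, a * b \in max_b n}.
Proof.
move=> a b; rewrite !mem_max_b => /andP[aPB ra] /andP[bPB rb].
rewrite PB_mul //=; apply: contra ra => /eqP rab.
have full c : c \in PB n -> npart_rank (a * b) <= npart_rank c ->
    npart_rank c != n - 1 -> c \in npart_sym n.
  move=> cPB le ne; rewrite npart_symE // eqn_leq npart_rank_le //=.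
  by move: le; rewrite rab leq_eqVlt eq_sym (negbTE ne) /= subn1 prednK.
have bS := full b bPB (npart_rank_mulR aPB bPB) rb.
apply: contraT => ra; have aS := full a aPB (npart_rank_mulL aPB bPB) ra.
have := npart_symM aPB bPB; rewrite aS bS => /rank_sym rk.
by have := n_sub (isT : 0 < 1); rewrite -{1}rk rab eqxx.
Qed.

Lemma rank_perm_mul s a : a \in PB n -> npart_rank (perm_part s * a) = npart_rank a.
Proof.
move=> aPB; apply/eqP; rewrite eqn_leq npart_rank_mulR //=.
have Ea : a = perm_part s^-1 * (perm_part s * a).
  by rewrite (mulgA (perm_part s^-1)) perm_partVK mul1g.
by rewrite {1}Ea npart_rank_mulR ?PB_mul.
Qed.

(** If [a * b] has rank [n - 2] and an upper pair, then either [a] is a unit and [b]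
    inherits both properties, or some upper point lies in no transverse block
    of [a]; its block persists in [a * b], so it is that upper pair. *)
Lemma max_c_mul : {in max_c n &, forall a b, a * b \in max_c n}.
Proof.
move=> a b; rewrite !mem_max_c => /andP[aPB ca] /andP[bPB cb].
have abPB := PB_mul aPB bPB; rewrite abPB /=.
apply: contra cb => /andP[rab /(npart_kerP abPB)[i [j [ij Eij]]]].
have [U0|] := eqVneq (udef a) set0.
  have [s Ea] := udef0_perm aPB U0.
  have Eb : b = perm_part s^-1 * (a * b).
    by rewrite Ea (mulgA (perm_part s^-1)) perm_partVK mul1g.
  rewrite Ea rank_perm_mul // in rab; rewrite rab /=; apply/(npart_kerP bPB).
  exists (s i), (s j); rewrite (inj_eq perm_inj) ij; split=> //.
  by rewrite Eb mate_perm_mul // permK Eij invgK.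
case/set0Pn=> m mU; case/negP: ca.
have Eji : mate (a * b) (inl j) = inl i by rewrite -Eij mateK.
have Uab : udef (a * b) = [set i; j].
  apply/esym/eqP; rewrite eqEcard cards2 ij; apply/andP; split.
    by apply/subsetP=> k; rewrite !inE => /orP[]/eqP->; rewrite ?Eij ?Eji.
  by rewrite rank_n2_udef // in rab; rewrite (eqP rab).
have [m' Em] := udefP _ _ mU.
have Emab := mate_mul_upper aPB bPB Em.
have mm' : m != m'.
  have := subsetP (udef_mul aPB bPB) m mU; rewrite Uab !inE.
  case/orP=> /eqP Ek; move: Emab; rewrite Ek ?Eij ?Eji => -[<-] //.
  by rewrite eq_sym.
have ka : ~~ trivial_equiv (npart_ker a) by apply/(npart_kerP aPB); exists m, m'.
rewrite ka andbT rank_n2_udef // eqn_leq; apply/andP; split.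
  by rewrite (leq_trans (subset_leq_card (udef_mul aPB bPB))) // Uab cards2 ij.
apply/card_gt1P; exists m, m'; split=> //.
by apply/udefP; exists m; rewrite -Em mateK.
Qed.

Lemma max_d_mul : {in max_d n &, forall a b, a * b \in max_d n}.
Proof.
by move=> a b; rewrite !mem_max_d_star star_mul => aM bM; apply: max_c_mul.
Qed.

(* The partitions [e] (rank n - 1) and [h], [e * h], [h * e] (rank n - 2) tell
   [max_b], [max_c] and [max_d] apart: [h] has an upper and a lower pair, [e * h] only a lower
   pair and [h * e] only an upper pair. *)
Let i0 : 'I_n := Ordinal n_gt0.
Let i1 : 'I_n := Ordinal n_gt1.
Let i01 : i0 != i1. Proof. by []. Qed.

Let e : npart n := hook i0 i0.
Let h : npart n := hook i0 i1.

Let ePB : e \in PB n. Proof. exact: hook_PB. Qed.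
Let hPB : h \in PB n. Proof. exact: hook_PB. Qed.
Let ehPB : e * h \in PB n. Proof. exact: PB_mul. Qed.
Let hePB : h * e \in PB n. Proof. exact: PB_mul. Qed.

Let e_rank : npart_rank e = n - 1.
Proof. by apply/eqP; rewrite rank_n1_udef // udef_hook setUid cards1. Qed.

Let h_rank : npart_rank h = n - 2.
Proof. by apply/eqP; rewrite rank_n2_udef // udef_hook cards2 i01. Qed.

Let heh : h * e * h = h. Proof. exact: hook_singleton_hook. Qed.

Let star_eh : star (e * h) = h * e.
Proof. by rewrite star_mul !star_hook. Qed.

Let eh_rank : npart_rank (e * h) = n - 2.
Proof.
apply/eqP; rewrite eqn_leq -{1}h_rank npart_rank_mulR //= -h_rank -{1}heh -mulgA.
exact: npart_rank_mulR.
Qed.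

Let he_rank : npart_rank (h * e) = n - 2.
Proof. by rewrite -star_eh npart_rank_star. Qed.

Let h_ker : ~~ trivial_equiv (npart_ker h).
Proof. by apply/(npart_kerP hPB); exists i0, i1; rewrite i01 mate_hook /= tpermL. Qed.

Let h_coker : ~~ trivial_equiv (npart_coker h).
Proof. by rewrite /npart_coker star_hook. Qed.

Let he_ker : ~~ trivial_equiv (npart_ker (h * e)).
Proof.
apply/(npart_kerP hePB); exists i0, i1; split=> //.
by apply: mate_mul_upper => //; rewrite mate_hook /= tpermL.
Qed.

Let eh_coker : ~~ trivial_equiv (npart_coker (e * h)).
Proof. by rewrite /npart_coker star_eh. Qed.

Let eh_ker : trivial_equiv (npart_ker (e * h)).
Proof.
apply: contraT => /(npart_kerP ehPB)[i [j [ij E]]].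
have E0 : mate (e * h) (inl i0) = inl i0.
  by apply: mate_mul_upper => //; rewrite mate_hook /= tpermL.
have Ej : mate (e * h) (inl j) = inl i by rewrite -E mateK.
have i0i : i0 != i by apply: contraNneq ij => Ei; move: E; rewrite -Ei E0 => -[->].
have i0j : i0 != j by apply: contraNneq ij => Ei; move: Ej; rewrite -Ei E0 => -[->].
have : [set i0; i; j] \subset udef (e * h).
  by apply/subsetP=> k; rewrite !inE => /orP[/orP[]|]/eqP->; rewrite ?E0 ?E ?Ej.
move/subset_leq_card; have := eh_rank => /eqP; rewrite rank_n2_udef // => /eqP->.
by rewrite -setUA cardsU1 cards2 !inE negb_or i0i i0j ij.
Qed.

Lemma subsemigroup_generate M a b c : subsemigroup (PB n) M -> npart_sym n \subset M ->
  a \in M -> npart_rank a = n - 1 ->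
  b \in M -> npart_rank b = n - 2 -> ~~ trivial_equiv (npart_ker b) ->
  c \in M -> npart_rank c = n - 2 -> ~~ trivial_equiv (npart_coker c) ->
  PB n \subset M.
Proof.
case/subsemigroupP=> _ sub mulM symM aM /eqP ra bM /eqP rb kb cM /eqP rc kc.
have aPB := subsetP sub _ aM; have bPB := subsetP sub _ bM; have cPB := subsetP sub _ cM.
apply: (generate mulM _ aM _ _ bM _ _ kb cM _ _ kc) => //.
- by move=> s; apply/(subsetP symM)/npart_symP; exists s.
- by apply/eqP; rewrite -rank_n1_udef.
- by apply/eqP; rewrite -rank_n2_udef.
- by apply/eqP; rewrite -rank_n2_udef.
Qed.

(** A proper subsemigroup that contains the units is maximal if adjoining any new
    element generates everything. *)
Lemma maximal_of_generate M : M \proper PB n -> npart_sym n \subset M ->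
  {in M &, forall a b, a * b \in M} ->
  (forall B a, subsemigroup (PB n) B -> M \subset B -> a \in B -> a \in PB n ->
     a \notin M -> PB n \subset B) ->
  maximal_subsemigroup (PB n) M.
Proof.
move=> prM symM mulM genM; apply/maxsetP; split=> /=.
  by rewrite prM andbT PB_subsemigroup // proper_sub.
move=> B /andP[semB prB] MB; apply/eqP; rewrite eqEsubset MB andbT.
apply/subsetP=> x xB; apply: contraT => xM.
have xPB := subsetP (proper_sub prB) _ xB.
by move: prB; rewrite properE (genM B x) ?andbF.
Qed.

Let n1n2 : (n - 1 == n - 2) = false.
Proof. by rewrite gtn_eqF // ltn_sub2l. Qed.

Let e_max_c : e \in max_c n.
Proof.
by rewrite mem_max_c ePB e_rank n1n2.
Qed.

Let e_max_d : e \in max_d n.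
Proof. by rewrite mem_max_d_star star_hook. Qed.

Let h_max_b : h \in max_b n.
Proof. by rewrite mem_max_b hPB h_rank eq_sym n1n2. Qed.

Let eh_max_c : e * h \in max_c n.
Proof. by rewrite mem_max_c ehPB eh_ker andbF. Qed.

Let he_max_d : h * e \in max_d n.
Proof. by rewrite mem_max_d_star star_mul !star_hook. Qed.

Let eNb : e \notin max_b n.
Proof. by rewrite mem_max_b e_rank eqxx andbF. Qed.

Let hNc : h \notin max_c n.
Proof. by rewrite mem_max_c h_rank eqxx h_ker andbF. Qed.

Let hNd : h \notin max_d n.
Proof. by rewrite mem_max_d h_rank eqxx h_coker andbF. Qed.

Let ehNd : e * h \notin max_d n.
Proof. by rewrite mem_max_d eh_rank eqxx eh_coker andbF. Qed.

Lemma max_b_proper : max_b n \proper PB n.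
Proof. by apply/properP; split; [exact: subsetDl | exists e]. Qed.

Lemma max_c_proper : max_c n \proper PB n.
Proof. by apply/properP; split; [exact: subsetDl | exists h]. Qed.

Lemma max_d_proper : max_d n \proper PB n.
Proof. by apply/properP; split; [exact: subsetDl | exists h]. Qed.

Lemma max_b_maximal : maximal_subsemigroup (PB n) (max_b n).
Proof.
have [sb _ _] := sym_sub_bcd.
apply: (maximal_of_generate max_b_proper sb max_b_mul) => B x semB MB xB xPB.
rewrite mem_max_b xPB negbK => /eqP rx.
by apply: (subsemigroup_generate semB _ xB rx (subsetP MB _ h_max_b) _ _
  (subsetP MB _ h_max_b)) => //; exact: (subset_trans sb MB).
Qed.

Lemma max_c_maximal : maximal_subsemigroup (PB n) (max_c n).
Proof.
have [_ sc _] := sym_sub_bcd.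
apply: (maximal_of_generate max_c_proper sc max_c_mul) => B x semB MB xB xPB.
rewrite mem_max_c xPB negbK => /andP[/eqP rx kx].
by apply: (subsemigroup_generate semB _ (subsetP MB _ e_max_c) _ xB rx kx
  (subsetP MB _ eh_max_c)) => //; exact: (subset_trans sc MB).
Qed.

Lemma max_d_maximal : maximal_subsemigroup (PB n) (max_d n).
Proof.
have [_ _ sd] := sym_sub_bcd.
apply: (maximal_of_generate max_d_proper sd max_d_mul) => B x semB MB xB xPB.
rewrite mem_max_d xPB negbK => /andP[/eqP rx kx].
by apply: (subsemigroup_generate semB _ (subsetP MB _ e_max_d) _
  (subsetP MB _ he_max_d) _ _ xB rx kx) => //; exact: (subset_trans sd MB).
Qed.

Lemma max_a_subsemigroup U : subgroup (npart_sym n) U -> subsemigroup (PB n) (max_a U).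
Proof.
case/and3P=> /subsemigroupP[_ sub mulU] U1 _; apply/subsemigroupP; split.
- by exists 1; rewrite mem_max_a // PB1 U1 implybT.
- by apply/subsetP=> a; rewrite mem_max_a // => /andP[].
move=> a b; rewrite !mem_max_a // => /andP[aPB /implyP aU] /andP[bPB /implyP bU].
rewrite PB_mul //=; apply/implyP; rewrite npart_symM // => /andP[aS bS].
by apply: mulU; [apply: aU | apply: bU].
Qed.

Lemma max_aI U : U \subset npart_sym n -> max_a U :&: npart_sym n = U.
Proof.
move=> sub; apply/setP=> a; rewrite inE mem_max_a //.
apply/andP/idP=> [[/andP[_ /implyP]]|aU]; first exact.
have aS := subsetP sub _ aU.
by rewrite aS aU (subsetP (npart_sym_PB n)).
Qed.

Lemma max_a_proper U : U \proper npart_sym n -> max_a U \proper PB n.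
Proof.
case/properP=> sub [a aS aU]; have aPB := subsetP (npart_sym_PB n) _ aS.
apply/properP; split; first by apply/subsetP=> b; rewrite mem_max_a // => /andP[].
by exists a; rewrite // mem_max_a // aS (negbTE aU) andbF.
Qed.

Lemma subgroup_sub U : subgroup (npart_sym n) U -> U \subset npart_sym n.
Proof. by case/and3P=> /subsemigroupP[]. Qed.

Lemma max_a_maximal U : maximal_subgroup (npart_sym n) U ->
  maximal_subsemigroup (PB n) (max_a U).
Proof.
case/maxsetP=> /andP[grU prU] maxU; have sub := proper_sub prU.
apply/maxsetP; split; first by rewrite /= max_a_subsemigroup // max_a_proper.
move=> B /andP[/subsemigroupP[_ BPB mulB] prB] UB.
have U1 : 1 \in U by case/and3P: grU.
have [|G EG] := sym_part_group mulB.
  exists 1; last exact: (subsetP sub).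
  by apply: (subsetP UB); rewrite mem_max_a // PB1 U1 implybT.
have grB : subgroup (npart_sym n) (B :&: npart_sym n) by apply/subgroupP; exists G.
have UBS : U \subset B :&: npart_sym n by rewrite -{1}(max_aI sub) setSI.
have prBS : B :&: npart_sym n \proper npart_sym n.
  rewrite properEneq subsetIr andbT; apply: contraTneq prB => /setIidPr symB.
  rewrite properE BPB /= negbK; apply/subsetP=> a aPB.
  have [/(subsetP symB)//|aS] := boolP (a \in npart_sym n).
  by apply: (subsetP UB); rewrite mem_max_a // aPB (negbTE aS).
have EU : B :&: npart_sym n = U by apply: maxU; rewrite //= grB.
apply/eqP; rewrite eqEsubset UB andbT; apply/subsetP=> b bB.
by rewrite mem_max_a // (subsetP BPB) //=; apply/implyP=> bS; rewrite -EU inE bB.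
Qed.

Lemma maximal_subsemigroup_cases M : maximal_subsemigroup (PB n) M ->
  [\/ exists2 U : {set npart n}, maximal_subgroup (npart_sym n) U & M = max_a U,
      M = max_b n, M = max_c n | M = max_d n].
Proof.
case/maxsetP=> /= /andP[semM prM] maxM.
have eqM X : maximal_subsemigroup (PB n) X -> M \subset X -> M = X.
  by case/maxsetP=> /= prX _ MX; rewrite (maxM X).
have /subsemigroupP[[x0 x0M] subM mulM] := semM.
have [symM|NsymM] := boolP (npart_sym n \subset M).
  have [/exists_inP[a aM /eqP ra]|Na] := boolP [exists a in M, npart_rank a == n - 1]; last first.
    constructor 2; apply: eqM max_b_maximal _; apply/subsetP=> a aM.
    by rewrite mem_max_b (subsetP subM) //=; apply: contra Na => ra; apply/exists_inP; exists a.
  have [/exists_inP[b bM /andP[/eqP rb kb]]|Nb] := boolP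
      [exists b in M, (npart_rank b == n - 2) && ~~ trivial_equiv (npart_ker b)]; last first.
    constructor 3; apply: eqM max_c_maximal _; apply/subsetP=> b bM.
    by rewrite mem_max_c (subsetP subM) //=; apply: contra Nb => rb; apply/exists_inP; exists b.
  have [/exists_inP[c cM /andP[/eqP rc kc]]|Nc] := boolP
      [exists c in M, (npart_rank c == n - 2) && ~~ trivial_equiv (npart_coker c)]; last first.
    constructor 4; apply: eqM max_d_maximal _; apply/subsetP=> c cM.
    by rewrite mem_max_d (subsetP subM) //=; apply: contra Nc => rc; apply/exists_inP; exists c.
  have := subsemigroup_generate semM symM aM ra bM rb kb cM rc kc.
  by move: prM; rewrite properE => /andP[_ /negbTE->].
constructor 1.
(* The singular part is an ideal, and adjoining it to [M] still leaves out a
   unit. *)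
have singM : PB n :\: npart_sym n \subset M.
  rewrite -(maxM (M :|: (PB n :\: npart_sym n))) ?subsetUl ?subsetUr //.
  apply/andP; split.
    apply/subsemigroupP; split; first by exists x0; rewrite inE x0M.
      by rewrite subUset subM subsetDl.
    move=> a b; rewrite !in_setU !in_setD => aX bX.
    have aPB : a \in PB n by case/orP: aX => [/(subsetP subM)//|/andP[]].
    have bPB : b \in PB n by case/orP: bX => [/(subsetP subM)//|/andP[]].
    rewrite PB_mul // npart_symM // andbT.
    case/orP: aX => [aM|/andP[/negbTE-> _]]; last by rewrite orbT.
    case/orP: bX => [bM|/andP[/negbTE-> _]]; last by rewrite andbF orbT.
    by rewrite mulM.
  apply/properP; split; first by rewrite subUset subM subsetDl.
  case/subsetPn: NsymM => a aS aM; exists a; first exact: (subsetP (npart_sym_PB n)).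
  by rewrite in_setU in_setD aS (negbTE aM).
(* [M] contains a unit, for otherwise adjoining 1 would give a larger proper
   subsemigroup, [n] being at least 2. *)
have [|G EG] := sym_part_group mulM.
  have gr1 : subgroup (npart_sym n) [set 1].
    apply/subgroupP; exists 1%G; apply/setP=> a; rewrite inE.
    apply/eqP/imsetP=> [->|[s /set1P-> ->]]; last exact: perm_part1.
    by exists 1; rewrite ?perm_part1 ?set11.
  have sub1 := subgroup_sub gr1.
  have [/existsP[a /andP[aM aS]]|none] := boolP [exists a, (a \in M) && (a \in npart_sym n)].
    by exists a.
  have E1 : max_a [set 1] = M.
    apply: maxM.
      rewrite /= max_a_subsemigroup // max_a_proper //; apply/properP; split=> //.
      exists (perm_part (tperm i0 i1)); first by apply/npart_symP; exists (tperm i0 i1).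
      rewrite inE -(perm_part1 n) (inj_eq (@perm_part_inj n)).
      by apply/eqP=> /permP/(_ i0); rewrite tpermL perm1.
    apply/subsetP=> a aM; rewrite mem_max_a // (subsetP subM) //=; apply/implyP=> aS.
    by case/negP: none; apply/existsP; exists a; rewrite aM.
  exists 1; last by rewrite (subsetP sub1) ?set11.
  by rewrite -E1 mem_max_a // PB1 set11 implybT.
pose U := M :&: npart_sym n.
have grU : subgroup (npart_sym n) U by apply/subgroupP; exists G.
have subU := subgroup_sub grU.
have EM : M = max_a U.
  apply/setP=> a; rewrite mem_max_a //; apply/idP/andP=> [aM|[aPB /implyP aU]].
    by split; [exact: (subsetP subM) | apply/implyP=> aS; rewrite inE aM].
  have [/aU|aS] := boolP (a \in npart_sym n); first by rewrite inE => /andP[].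
  by apply: (subsetP singM); rewrite in_setD aS.
exists U => //; apply/maxsetP; split.
  rewrite /= grU properEneq subU andbT; apply: contraNneq NsymM => /setIidPr; exact.
move=> B /andP[grB prB] UB; have subB := proper_sub prB.
rewrite -(max_aI subB) (maxM (max_a B)) //; first by rewrite max_a_subsemigroup // max_a_proper.
by rewrite {1}EM setUS.
Qed.

Lemma maximal_subsemigroup_PB M : maximal_subsemigroup (PB n) M <->
  [\/ exists2 U : {set npart n}, maximal_subgroup (npart_sym n) U & M = max_a U,
      M = max_b n, M = max_c n | M = max_d n].
Proof.
split; first exact: maximal_subsemigroup_cases.
case=> [[U maxU ->]|->|->|->].
- exact: max_a_maximal.
- exact: max_b_maximal.
- exact: max_c_maximal.
- exact: max_d_maximal.
Qed.

Lemma card_maximal_subsemigroup :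
  #|[set M : {set npart n} | maximal_subsemigroup (PB n) M]| =
  (#|[set G : {group 'S_n} | maximal G [set: 'S_n]]| + 3)%N.
Proof.
pose F (G : {group 'S_n}) := [set perm_part s | s in G].
have FP (G : {group 'S_n}) : maximal G [set: 'S_n] -> maximal_subgroup (npart_sym n) (F G).
  by move=> maxG; apply/maximal_subgroupP; exists G.
have Fsub (G : {group 'S_n}) : F G \subset npart_sym n.
  by apply/subgroup_sub/subgroupP; exists G.
have -> : [set M : {set npart n} | maximal_subsemigroup (PB n) M] =
    [set max_a (F G) | G in [set G : {group 'S_n} | maximal G [set: 'S_n]]]
    :|: [set max_b n; max_c n; max_d n].
  apply/setP=> M; rewrite in_setU [LHS]inE; apply/idP/orP.
    case/maximal_subsemigroup_PB=> [[U /maximal_subgroupP[G maxG ->] ->]|->|->|->].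
    - by left; apply: imset_f; rewrite inE.
    - by right; rewrite !inE eqxx.
    - by right; rewrite !inE eqxx ?orbT.
    - by right; rewrite !inE eqxx ?orbT.
  case=> [/imsetP[G]|].
    by rewrite inE => /FP maxG ->; apply: max_a_maximal.
  rewrite !inE => /orP[/orP[]|]/eqP->.
  - exact: max_b_maximal.
  - exact: max_c_maximal.
  - exact: max_d_maximal.
have disj : [disjoint [set max_a (F G) | G in [set G : {group 'S_n} | maximal G [set: 'S_n]]]
    & [set max_b n; max_c n; max_d n]].
  rewrite disjoint_subset; apply/subsetP=> _ /imsetP[G + ->].
  rewrite !inE => /FP/maxsetP[/andP[_ prG] _].
  have [sb sc sd] := sym_sub_bcd.
  have N (X : {set npart n}) : npart_sym n \subset X -> max_a (F G) != X.
    apply: contraTneq => <-; apply: contraTN prG => symX.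
    by rewrite properE -{2}(max_aI (Fsub G)) subsetI symX subxx andbF.
  by rewrite !negb_or !N.
rewrite cardsU disjoint_setI0 // cards0 subn0; congr (_ + _)%N.
  rewrite card_in_imset // => G H _ _ E; apply: group_inj.
  have EF : F G = F H by rewrite -(max_aI (Fsub G)) E max_aI.
  exact: (imset_inj (@perm_part_inj n) EF).
rewrite -setUA cardsU1 cards2 !inE negb_or.
have -> : max_b n != max_c n by apply: contraNneq hNc => <-.
have -> : max_b n != max_d n by apply: contraNneq hNd => <-.
by have -> : max_c n != max_d n by apply: contraNneq ehNd => <-.
Qed.

(** * Green's classes and types *)

Lemma principalP a b :
  reflect (exists p q, [/\ p \in PB n, q \in PB n & b = p * a * q])
          (b \in PB n * [set a] * PB n).
Proof.
apply: (iffP mulsgP) => [[_ q /mulsgP[p _ pPB /set1P-> ->] qPB ->]|[p [q [pPB qPB ->]]]].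
  by exists p, q.
by exists (p * a) q => //; apply/mulsgP; exists p a; rewrite ?set11.
Qed.

Lemma principal_sub a b p q : p \in PB n -> q \in PB n -> b = p * a * q ->
  PB n * [set b] * PB n \subset PB n * [set a] * PB n.
Proof.
move=> pPB qPB Eb; apply/subsetP=> c /principalP[p' [q' [p'PB q'PB ->]]].
apply/principalP; exists (p' * p), (q * q'); rewrite !PB_mul //; split=> //.
by rewrite Eb; apply: mulg_nested.
Qed.

Lemma principal_eq a b p q p' q' :
  p \in PB n -> q \in PB n -> b = p * a * q ->
  p' \in PB n -> q' \in PB n -> a = p' * b * q' ->
  PB n * [set b] * PB n = PB n * [set a] * PB n.
Proof.
move=> pPB qPB Eb p'PB q'PB Ea.
by apply/eqP; rewrite eqEsubset (principal_sub pPB qPB Eb) (principal_sub p'PB q'PB Ea).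
Qed.

Lemma principal_rank a b : a \in PB n ->
  PB n * [set b] * PB n \subset PB n * [set a] * PB n -> npart_rank b <= npart_rank a.
Proof.
move=> aPB /subsetP sub.
have /sub/principalP[p [q [pPB qPB ->]]] : b \in PB n * [set b] * PB n.
  by apply/principalP; exists 1, 1; rewrite mul1g mulg1 PB1; split.
by rewrite (leq_trans (npart_rank_mulL _ _)) ?PB_mul // npart_rank_mulR.
Qed.

Lemma Jclass_rank a b : a \in PB n -> b \in Jclass (PB n) a ->
  npart_rank b = npart_rank a.
Proof.
by move=> aPB; rewrite inE => /andP[bPB /eqP E]; apply/eqP; rewrite eqn_leq !principal_rank // E.
Qed.

Lemma Jclass_hook i j k l : (i == j) = (k == l) ->
  PB n * [set hook k l] * PB n = PB n * [set hook i j] * PB n.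
Proof.
move=> Eij; have [s [<- <-]] : exists s, s i = k /\ s j = l.
  have [Ei|ij] := eqVneq i j; last by apply: perm_pair; rewrite // -Eij (negbTE ij).
  move: Eij; rewrite Ei eqxx => /esym/eqP->; exists (tperm j l); by rewrite tpermL.
have EL : perm_part s^-1 * hook i j * perm_part s = hook (s i) (s j).
  exact: hook_conj.
have ER : perm_part s * hook (s i) (s j) * perm_part s^-1 = hook i j.
  by rewrite hook_conjV.
by apply: (principal_eq _ _ (esym EL) _ _ (esym ER)); apply: perm_part_PB.
Qed.

Lemma hook_ker_fix_hook i j a : hook i j * ker_fix a i * hook i j = hook i j.
Proof.
rewrite /ker_fix; case: ifP => _; first exact: hook_singleton_hook.
by rewrite mulg1 hook_idem.
Qed.

Lemma ker_fix_PB a i : ker_fix a i \in PB n.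
Proof. by rewrite /ker_fix; case: ifP; rewrite ?hook_PB ?PB1. Qed.

(** Every [a] of rank [n - 1] or [n - 2] is a product of a hook [g] with outer
    factors [p], [q] such that [g * p * g = g = g * q * g], and a unit. Both the
    regularity of [a] and its J-equivalence to [g] follow. *)
Lemma rank12_sandwich a d : a \in PB n -> npart_rank a = n - d -> 0 < d <= 2 ->
  exists i j p q s, [/\ p \in PB n /\ q \in PB n, hook i j * p * hook i j = hook i j,
    hook i j * q * hook i j = hook i j, a = p * hook i j * q * perm_part s
    & (i == j) = (d == 1%N)].
Proof.
move=> aPB /eqP; case: d => [|[|[|d]]] //= ra _.
  have [i [s Ea]] : exists i s, a = hook i i * perm_part s.
    by apply: defect1_factor => //; apply/eqP; rewrite -rank_n1_udef.
  exists i, i, 1, 1, s; rewrite mulg1 hook_idem mul1g mulg1 !PB1 eqxx; split=> //.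
have [i [j [s [ij Ea]]]] : exists i j s, i != j /\
    a = ker_fix a i * hook i j * ker_fix (star a) i * perm_part s.
  by apply: defect2_factor => //; apply/eqP; rewrite -rank_n2_udef.
exists i, j, (ker_fix a i), (ker_fix (star a) i), s.
split; first by split; exact: ker_fix_PB.
- exact: hook_ker_fix_hook.
- exact: hook_ker_fix_hook.
- exact: Ea.
exact: negbTE.
Qed.

Lemma Jclass_rank12 d k l : 0 < d <= 2 -> (k == l) = (d == 1%N) ->
  npart_rank (hook k l) = n - d ->
  Jclass (PB n) (hook k l) = [set a in PB n | npart_rank a == n - d].
Proof.
move=> d12 Ekl rkl; apply/setP=> a; rewrite [RHS]inE.
apply/idP/andP=> [aJ|[aPB /eqP ra]].
  rewrite (Jclass_rank (hook_PB k l) aJ) rkl; split=> //.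
  by move: aJ; rewrite inE => /andP[].
rewrite inE aPB /=; apply/eqP.
have [i [j [p [q [s [[pPB qPB] hph hqh Ea Eij]]]]]] := rank12_sandwich aPB ra d12.
rewrite (@Jclass_hook i j k l); last by rewrite Eij.
have Eh := sandwich_recover (perm_partK s) hph hqh; rewrite -Ea in Eh.
have Ea' : a = p * hook i j * (q * perm_part s) by rewrite Ea; apply: esym; apply: mulgA.
by apply: (principal_eq _ _ Ea' _ _ (esym Eh)); rewrite ?PB_mul ?perm_part_PB ?hook_PB.
Qed.

Lemma Jclass_e : Jclass (PB n) e = [set a in PB n | npart_rank a == n - 1].
Proof. by apply: Jclass_rank12 => //; rewrite eqxx. Qed.

Lemma Jclass_h : Jclass (PB n) h = [set a in PB n | npart_rank a == n - 2].
Proof. exact: Jclass_rank12. Qed.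

Lemma regular_rank12 d : 0 < d <= 2 ->
  regular_set (PB n) [set a in PB n | npart_rank a == n - d].
Proof.
move=> d12 a; rewrite inE => /andP[aPB /eqP ra].
have [i [j [p [q [s [[pPB qPB] hph hqh Ea _]]]]]] := rank12_sandwich aPB ra d12.
exists (perm_part s^-1 * hook i j); first by rewrite PB_mul ?perm_part_PB ?hook_PB.
by rewrite Ea; apply: (sandwich_regular (perm_partK s) hph hqh).
Qed.

Lemma Jclass_1 : Jclass (PB n) 1 = npart_sym n.
Proof.
apply/setP=> a; apply/idP/idP=> [aJ|/npart_symP[s ->]].
  have aPB : a \in PB n by move: aJ; rewrite inE => /andP[].
  rewrite npart_symE // (Jclass_rank (PB1 n) aJ) rank_sym //.
  by apply/npart_symP; exists 1; rewrite perm_part1.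
rewrite inE perm_part_PB; apply/eqP.
apply: (@principal_eq _ _ (perm_part s) 1 (perm_part s^-1) 1); rewrite ?PB1 ?perm_part_PB //.
  by rewrite !mulg1.
by rewrite mulg1 perm_partVK.
Qed.

Lemma max_a_typeM5 U : maximal_subgroup (npart_sym n) U -> typeM5 (PB n) (max_a U).
Proof.
move=> maxU; have /maxsetP[/andP[grU _] _] := maxU.
have sub := subgroup_sub grU; have U1 : 1 \in U by case/and3P: grU.
exists (npart_sym n).
  split.
  - exact: max_a_maximal.
  - by exists 1; rewrite ?PB1 ?Jclass_1.
  - move=> a /npart_symP[s ->]; exists (perm_part s^-1); first exact: perm_part_PB.
    by rewrite perm_partK mul1g.
  apply/subsetP=> a; rewrite inE mem_max_a // => /andP[+ aPB].
  by rewrite aPB negb_imply => /andP[].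
move=> a /npart_symP[s ->]; apply/set0Pn; exists 1.
have LS : PB n * [set perm_part s] = PB n.
  apply/setP=> c; apply/mulsgP/idP=> [[p _ pPB /set1P-> ->]|cPB]; first by rewrite PB_mul ?perm_part_PB.
  exists (c * perm_part s^-1) (perm_part s); rewrite ?PB_mul ?set11 ?perm_part_PB //.
  by rewrite -mulgA perm_partVK mulg1.
have RS : [set perm_part s] * PB n = PB n.
  apply/setP=> c; apply/mulsgP/idP=> [[_ p /set1P-> pPB ->]|cPB]; first by rewrite PB_mul ?perm_part_PB.
  exists (perm_part s) (perm_part s^-1 * c); rewrite ?PB_mul ?set11 ?perm_part_PB //.
  by rewrite (mulgA (perm_part s)) perm_partK mul1g.
rewrite inE mem_max_a // PB1 U1 implybT /= in_setI [X in X && _]inE [X in _ && X]inE PB1 /=.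
by rewrite LS RS mulg1 mul1g !eqxx.
Qed.

Lemma max_b_typeM1 : typeM1 (PB n) (max_b n).
Proof.
exists (Jclass (PB n) e).
  split.
  - exact: max_b_maximal.
  - by exists e.
  - by rewrite Jclass_e; apply: regular_rank12.
  by rewrite Jclass_e setDDr setDv set0U subsetIr.
rewrite Jclass_e; apply/setP=> a; rewrite in_setI in_set0 mem_max_b [X in _ && X]inE.
by case: (npart_rank a == _); rewrite /= ?andbF.
Qed.

Let arises_h M : maximal_subsemigroup (PB n) M ->
  (forall a, a \in PB n -> a \notin M -> npart_rank a = n - 2) ->
  arises_from_regular (PB n) M (Jclass (PB n) h).
Proof.
move=> maxM rM; split=> //; first by exists h.
  by rewrite Jclass_h; apply: regular_rank12.
rewrite Jclass_h; apply/subsetP=> a; rewrite in_setD => /andP[aM aPB].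
by rewrite inE aPB (rM a) ?eqxx.
Qed.

Lemma max_c_typeM4 : typeM4 (PB n) (max_c n).
Proof.
exists (Jclass (PB n) h).
  apply: arises_h max_c_maximal _ => a aPB.
  by rewrite mem_max_c aPB negbK => /andP[/eqP].
exists (max_c n :&: Jclass (PB n) h); split; first exact: subsetIr.
  by apply/set0Pn; exists (e * h); rewrite inE eh_max_c Jclass_h inE ehPB eh_rank eqxx.
rewrite Jclass_h; apply/setP=> a; apply/idP/bigcupP=> [aM|].
  exists a => //; rewrite inE eqxx andbT.
  by move: aM; rewrite inE => /andP[_]; rewrite inE => /andP[].
case=> b; rewrite inE mem_max_c [in X in _ && X]inE => /andP[/andP[bPB cb] /andP[_ rb]].
rewrite inE => /andP[aPB /eqP E].
have mulE c c' : c \in PB n -> [set c] * PB n = [set c'] * PB n ->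
    exists2 p, p \in PB n & c = c' * p.
  move=> cPB Ec; have : c \in [set c] * PB n by apply: (subsetP (mulg_subl [set c] (PB1 n))); exact: set11.
  by rewrite Ec => /mulsgP[_ p /set1P-> pPB ->]; exists p.
have [p pPB Ea] := mulE _ _ aPB E; have [q qPB Eb] := mulE _ _ bPB (esym E).
have ra : npart_rank a == n - 2.
  rewrite -(eqP rb) eqn_leq {1}Ea npart_rank_mulL //= {1}Eb npart_rank_mulL //.
rewrite inE mem_max_c aPB [X in _ && X]inE aPB ra /= negbK andbT.
move: cb; rewrite rb /= negbK; apply: contraTT => /(npart_kerP aPB)[i [j [ij Eij]]].
apply/(npart_kerP bPB); exists i, j; split=> //.
by rewrite Eb; apply: mate_mul_upper.
Qed.

Lemma max_d_typeM3 : typeM3 (PB n) (max_d n).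
Proof.
exists (Jclass (PB n) h).
  apply: arises_h max_d_maximal _ => a aPB.
  by rewrite mem_max_d aPB negbK => /andP[/eqP].
exists (max_d n :&: Jclass (PB n) h); split; first exact: subsetIr.
  by apply/set0Pn; exists (h * e); rewrite inE he_max_d Jclass_h inE hePB he_rank eqxx.
rewrite Jclass_h; apply/setP=> a; apply/idP/bigcupP=> [aM|].
  exists a => //; rewrite inE eqxx andbT.
  by move: aM; rewrite inE => /andP[_]; rewrite inE => /andP[].
case=> b; rewrite inE mem_max_d [in X in _ && X]inE => /andP[/andP[bPB cb] /andP[_ rb]].
rewrite inE => /andP[aPB /eqP E].
have mulE c c' : c \in PB n -> PB n * [set c] = PB n * [set c'] ->
    exists2 p, p \in PB n & c = p * c'.
  move=> cPB Ec; have : c \in PB n * [set c] by apply: (subsetP (mulg_subr [set c] (PB1 n))); exact: set11.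
  by rewrite Ec => /mulsgP[p _ pPB /set1P-> ->]; exists p.
have [p pPB Ea] := mulE _ _ aPB E; have [q qPB Eb] := mulE _ _ bPB (esym E).
have ra : npart_rank a == n - 2.
  rewrite -(eqP rb) eqn_leq {1}Ea npart_rank_mulR //= {1}Eb npart_rank_mulR //.
rewrite inE mem_max_d aPB [X in _ && X]inE aPB ra /= negbK andbT.
move: cb; rewrite rb /= negbK; apply: contraTT => /(npart_cokerP aPB)[i [j [ij Eij]]].
apply/(npart_cokerP bPB); exists i, j; split=> //.
by rewrite Eb; apply: mate_mul_lower.
Qed.

End Subsemigroups.

(** * Degree one *)

Section DegreeOne.

Lemma PB_degree1 : PB 1 = [set: npart 1].
Proof.
apply/setP=> a; rewrite in_setT; apply/mem_PB=> x y z _ _.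
by case: x y z => x [] y [] z; rewrite (ord1 x) (ord1 y) (ord1 z) eqxx ?orbT.
Qed.

Lemma npart_degree1 (a : npart 1) : a = 1 \/ a = hook ord0 ord0.
Proof.
have aPB : a \in PB 1 by rewrite PB_degree1 inE.
have perm1 (s : 'S_1) : perm_part s = 1.
  rewrite -(perm_part1 1); congr perm_part; apply/permP=> i.
  by rewrite [LHS]ord1 [RHS]ord1.
have [U0|] := eqVneq (udef a) set0.
  by left; have [s ->] := udef0_perm aPB U0.
rewrite -card_gt0 => U1; right.
have [|i [s ->]] := defect1_factor aPB; last by rewrite perm1 mulg1 (ord1 i).
by apply/eqP; rewrite eqn_leq U1 andbT -[leqRHS](card_ord 1) max_card.
Qed.

Lemma PB_degree1E : PB 1 = [set 1; hook ord0 ord0].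
Proof.
apply/setP=> a; rewrite PB_degree1 in_setT !inE.
by case: (npart_degree1 a) => ->; rewrite eqxx ?orbT.
Qed.

Lemma card_PB_degree1 : #|PB 1| = 2.
Proof.
rewrite PB_degree1E cards2; suff -> : 1 != hook ord0 ord0 :> npart 1 by [].
apply/eqP=> E; have := udef_hook (ord0 : 'I_1) ord0.
rewrite -E -(perm_part1 1) udef_perm => /setP/(_ ord0).
by rewrite !inE.
Qed.

Lemma semilattice_PB_degree1 : semilattice (PB 1).
Proof.
split.
- by apply/subsetP=> _ /mulsgP[a b aPB bPB ->]; apply: PB_mul.
- move=> a b _ _; case: (npart_degree1 a) (npart_degree1 b) => -> [] ->;
    by rewrite ?mulg1 ?mul1g.
- by move=> a _; case: (npart_degree1 a) => ->; rewrite ?mulg1 ?hook_idem.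
Qed.

Lemma maximal_subsemigroup_PB_degree1 (M : {set npart 1}) :
  maximal_subsemigroup (PB 1) M <-> exists2 a, a \in PB 1 & M = [set a].
Proof.
have [_ _ idem] := semilattice_PB_degree1.
split=> [/maxsetP[/andP[/subsemigroupP[[a aM] sub _] prM] _]|[a aPB ->]].
  have M1 : #|M| < #|PB 1| by apply: proper_card.
  rewrite card_PB_degree1 ltnS in M1; exists a; first exact: (subsetP sub).
  by apply/esym/eqP; rewrite eqEcard sub1set aM cards1.
apply/maxsetP; split=> [|B /andP[_ prB] aB].
  rewrite /= properEcard sub1set aPB cards1 card_PB_degree1 andbT.
  apply/subsemigroupP; split; rewrite ?sub1set //; first by exists a; rewrite set11.
  by move=> b c /set1P-> /set1P->; rewrite idem ?set11.
have B1 : #|B| < #|PB 1| by apply: proper_card.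
rewrite card_PB_degree1 ltnS in B1.
by apply/esym/eqP; rewrite eqEcard aB cards1.
Qed.

End DegreeOne.

Local Close Scope group_scope.

Theorem theorem4p3 :
  (forall n : nat, 2 <= n ->
     [/\ forall M : {set npart n},
           maximal_subsemigroup (PB n) M <->
           [\/ exists2 U : {set npart n},
                 maximal_subgroup (npart_sym n) U & M = max_a U,
               M = max_b n, M = max_c n | M = max_d n],
         [/\ forall U : {set npart n},
               maximal_subgroup (npart_sym n) U -> typeM5 (PB n) (max_a U),
             typeM1 (PB n) (max_b n),
             typeM4 (PB n) (max_c n)
           & typeM3 (PB n) (max_d n)]
       & #|[set M : {set npart n} | maximal_subsemigroup (PB n) M]|
         = #|[set G : {group 'S_n} | maximal G [set: 'S_n]]| + 3])
  /\
  [/\ PB 1 = [set: npart 1], semilattice (PB 1), #|PB 1| = 2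
    & forall M : {set npart 1},
        maximal_subsemigroup (PB 1) M <->
        exists2 a, a \in PB 1 & M = [set a]].
Proof.
split=> [n n_gt1|].
  split; first exact: maximal_subsemigroup_PB.
    split.
    - exact: max_a_typeM5.
    - exact: max_b_typeM1.
    - exact: max_c_typeM4.
    - exact: max_d_typeM3.
  exact: card_maximal_subsemigroup.
split; first exact: PB_degree1.
- exact: semilattice_PB_degree1.
- exact: card_PB_degree1.
- exact: maximal_subsemigroup_PB_degree1.
Qed.
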